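(* Assume $x^{(0)}\neq0$. (a) If $a=0$, then for every $\sigma>0$, $x^{(k)}\to0$ almost surely as $k\to\infty$. (b) If $a\in(0,1]$, then $\mu_a(\sigma)<0$ if and only if $\sigma=\bar\sigma_a(s,d)$ for some $s>0$. In that case, if $s\ge1$ then $x^{(k)}\to0$ almost surely; if $s<1$ then $\mathbb E\|x^{(k)}\|^p\to0$ for every $p\in(0,s)$ and some subsequence $x^{(n_k)}$ converges to $0$ almost surely. (c) If $a\in(0,1]$ and $\mu_a(\sigma)>0$, then $\mathbb E\|x^{(k)}\|^p\to\infty$ for every $p>0$, and some subsequence satisfies $\|x^{(n_k)}\|\to\infty$ almost surely.
   Context: Fix an integer width $d\ge1$ and a parameter $a\in[0,1]$. The parametric ReLU $\phi_a:\mathbb{R}\to\mathbb{R}$ is $\phi_a(z)=z$ for $z>0$ and $\phi_a(z)=az$ for $z\le 0$; it is applied componentwise to vectors ($\phi_0$ is ReLU, $\phi_1$ is the identity). Given $\sigma>0$ and a deterministic input $x^{(0)}\in\mathbb{R}^d$, the layer outputs of the fully connected network with zero biases are $x^{(k+1)}=\phi_a(W^{(k+1)}x^{(k)})$, $k\ge0$, where all entries of all matrices $W^{(1)},W^{(2)},\dots\in\mathbb{R}^{d\times d}$ are i.i.d. $\mathcal{N}(0,\sigma^2)$. $\|\cdot\|$ denotes the Euclidean norm. With $Z\sim\mathcal N(0,I_d)$: $\mu_a(\sigma)=\log\sigma+\frac12\mathbb E[\log\|\phi_a(Z)\|^2]$, and for $s>0$, $\bar\sigma_a(s,d)=\big(\mathbb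 E\|\phi_a(Z)\|^s\big)^{-1/s}$. *)

(* Defs.v *)
From HB Require Import structures.
From mathcomp Require Import all_boot all_order all_algebra.
From mathcomp Require Import all_classical all_reals all_analysis.

Set Implicit Arguments.
Unset Strict Implicit.
Unset Printing Implicit Defensive.

Import Order.TTheory GRing.Theory Num.Theory.
Import numFieldNormedType.Exports.

Local Open Scope classical_set_scope.
Local Open Scope ring_scope.

Section defs.
Context {R : realType}.

Definition prelu (a z : R) : R := if 0 < z then z else a * z.

Definition prelu_vec (a : R) {d : nat} (v : 'cV[R]_d) : 'cV[R]_d :=
  map_mx (prelu a) v.

Definition enorm {d : nat} (v : 'cV[R]_d) : R :=
  Num.sqrt (\sum_(i < d) v i 0 ^+ 2).

(* Layer outputs: layers a x0 W 0 = x0 and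
   layers a x0 W k.+1 = phi_a (W k *m layers a x0 W k).
   W k plays the role of the paper's W^{(k+1)}. *)
Fixpoint layers (a : R) {d : nat} {T : Type} (x0 : 'cV[R]_d)
  (W : nat -> T -> 'M[R]_d) (k : nat) (w : T) : 'cV[R]_d :=
  match k with
  | 0%N => x0
  | k'.+1 => prelu_vec a (W k' w *m layers a x0 W k' w)
  end.

Definition mutually_independent {dT : measure_display} {T : measurableType dT}
  (P : probability T R) {I : eqType} (X : I -> T -> R) : Prop :=
  forall (J : seq I) (B : I -> set R), uniq J ->
    (forall i, measurable (B i)) ->
    P (\big[setI/setT]_(i <- J) (X i @^-1` B i)) =
    (\prod_(i <- J) P (X i @^-1` B i))%E.

Definition iid_gaussian {dT : measure_display} {T : measurableType dT}
  (P : probability T R) {I : eqType} (X : I -> T -> R) (s : R) : Prop :=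
  [/\ forall i, measurable_fun setT (X i),
      forall i (B : set R), measurable B -> P (X i @^-1` B) = normal_prob 0 s B
    & mutually_independent P X].

Definition mu_a {dT : measure_display} {T : measurableType dT}
  (P : probability T R) {d : nat} (Zs : 'I_d -> T -> R) (a sigma : R) : \bar R :=
  ((ln sigma)%:E +
   (2^-1)%:E * \int[P]_w (ln (enorm (prelu_vec a (\col_i Zs i w)) ^+ 2))%:E)%E.

Definition sigma_bar {dT : measure_display} {T : measurableType dT}
  (P : probability T R) {d : nat} (Zs : 'I_d -> T -> R) (a s : R) : R :=
  (fine (\int[P]_w ((enorm (prelu_vec a (\col_i Zs i w))) `^ s)%:E)) `^ (- s^-1).

End defs.

(* Main.v *)
Require Import Defs.
From HB Require Import structures.
From mathcomp Require Import all_boot all_order all_algebra.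
From mathcomp Require Import all_classical all_reals all_analysis.
From mathcomp Require Import measurable_realfun.
From mathcomp Require Import ring lra.

Set Implicit Arguments.
Unset Strict Implicit.
Unset Printing Implicit Defensive.

Import Order.TTheory GRing.Theory Num.Theory.
Import numFieldNormedType.Exports.
Local Open Scope classical_set_scope.
Local Open Scope ring_scope.

(** Since the rows of a Gaussian matrix are rotation invariant, given the past
    the norm of the layer [x_(k+1)] is distributed as [sigma |x_k| V] with
    [V = |phi_a Z|] independent of [x_k].  Hence [E g(|x_k|) = g(|x_0|) r^k] with
    [r = E g(sigma V)] for every nonnegative multiplicative [g], and if [r < 1]
    then [sum_k E g(|x_k|)] is finite, so that [g(|x_k|)] tends to [0] almost
    surely; neither a law of large numbers nor a martingale theorem is needed.
    For [a = 0] take [g = 1_(u != 0)], with [r = P(V != 0) < 1].  For [a > 0] put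
    [Y = ln (sigma V)] and [psi t = E e^(t Y)], so that [mu_a = E Y] and
    [sigma = sigma_bar s] means [psi s = 1].  By convexity [psi s = 1] implies
    [E Y < 0] and [psi p < 1] for [0 < p < s]: take [g = u^p].  Conversely, if
    [E Y < 0] then [psi < 1] near [0+] while [psi] is continuous and unbounded.
    If [E Y > 0] then [psi p > 1] for [p > 0], and [psi (- q) < 1] for some small
    [q > 0]: taking [g = u^(-q)] shows that [|x_k|] tends to infinity. *)

(** * Gaussian integrals *)

(** Rotation invariance is never applied to the law of a vector in R^d. It is reduced to one planar
    fact, [integral_normal_rotate], used once per matrix entry while everything else is frozen.
    [cond_law] expresses freezing through test functions of the past and one more variable, so
    conditional expectations do not occur. A layer is followed through its squared norm because this
    is a sum over rows, and the rows involve disjoint fresh entries. Only exponents t >= -1/2 are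
    used. For a > 0, P(V <= r) is at most of order r in every dimension d >= 1, so negative moments
    of order below 1 are finite; 1/2 is a convenient choice. Positive moments are finite because
    exp(V^2 / (4 d)) is integrable. Since [ln 0 = 0] and a nonzero power of 0 is 0, powers and
    exponentials of logarithms agree only where V > 0, which for a > 0 is almost sure. In (b) and
    (c) the almost sure limit holds along the whole sequence, so the subsequence is [id]. *)

Section gaussian.
Context {R : realType}.
Local Notation mu := (@lebesgue_measure R).
Implicit Types (f : R -> \bar R) (m s : R).

(** The Radon-Nikodym derivative of the normal law and [normal_pdf] have the same integral over
    every measurable set, hence agree almost everywhere. *)
Lemma ge0_integral_normal_prob m s f :
  measurable_fun setT f -> (forall x, 0 <= f x)%E ->
  (\int[normal_prob m s]_x f x = \int[mu]_x (f x * (normal_pdf m s x)%:E))%E.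
Proof.
move=> mf f0.
have dom := normal_prob_dominates m s.
rewrite -(Radon_Nikodym_SigmaFinite.change_of_variables dom)//=.
have intRN := Radon_Nikodym_SigmaFinite.f_integrable dom.
apply: ae_eq_integral => //.
- apply: emeasurable_funM => //; exact: measurable_int intRN.
- apply: emeasurable_funM => //=; apply/measurableT_comp => //=.
  exact: measurable_normal_pdf.
- apply: ae_eqe_mul2l => /=.
  apply: integral_ae_eq => //=.
  + by apply/measurableT_comp =>//; exact: measurable_normal_pdf.
  + move=> E _ mE; rewrite -(Radon_Nikodym_SigmaFinite.f_integral dom)//.
Qed.

(** By uniqueness of Lebesgue measure it suffices to test half-open intervals; for a < 0 the
    preimage is half-open on the other side, which does not change its length. *)
Lemma lebesgue_measure_affine (a b : R) (A : set R) : a != 0 -> measurable A ->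
  (`|a|%:E * mu ((fun x => a * x + b)%R @^-1` A) = mu A)%E.
Proof.
move=> a0 mA.
have mf : measurable_fun setT ((fun x => a * x + b) : measurableTypeR R -> measurableTypeR R).
  by apply: measurable_funD => //; exact: measurable_funM.
pose na : {nonneg R} := NngNum (normr_ge0 a).
apply/esym.
apply: (@lebesgue_measure_unique R (mscale na (pushforward mu
  ((fun x => a * x + b) : measurableTypeR R -> measurableTypeR R)))) => //= _ [[c d]] _ <-.
rewrite /mscale/= /pushforward/=.
move: a0; rewrite neq_lt => /orP[a0|a0].
- have -> : (fun x => a * x + b) @^-1` `]c, d] = `[(d - b) / a, (c - b) / a[%classic.
    apply/seteqP; split => x /=; rewrite !in_itv/= ler_ndivrMr// ltr_ndivlMr//; lra.
  rewrite !lebesgue_measure_itv/= !lte_fin ltr_ndivrMr// mulfVK ?lt_eqF// ltrD2r.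
  case: ifPn => // cd; last by rewrite mule0.
  by rewrite -!EFinB -EFinM; congr (_%:E); rewrite ltr0_norm//; field; rewrite lt_eqF.
- have -> : (fun x => a * x + b) @^-1` `]c, d] = `](c - b) / a, (d - b) / a]%classic.
    apply/seteqP; split => x /=; rewrite !in_itv/= ler_pdivlMr// ltr_pdivrMr//; lra.
  rewrite !lebesgue_measure_itv/= !lte_fin ltr_pdivrMr// mulfVK ?gt_eqF// ltrD2r.
  case: ifPn => // cd; last by rewrite mule0.
  by rewrite -!EFinB -EFinM; congr (_%:E); rewrite gtr0_norm//; field; rewrite gt_eqF.
Qed.

Lemma ge0_integral_affine (a b : R) f : a != 0 ->
  measurable_fun setT f -> (forall x, 0 <= f x)%E ->
  (\int[mu]_x f x = \int[mu]_x (`|a|%:E * f (a * x + b)%R))%E.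
Proof.
move=> a0 mf f0.
have mT : measurable_fun setT ((fun x => a * x + b) : measurableTypeR R -> measurableTypeR R).
  by apply: measurable_funD => //; exact: measurable_funM.
pose na : {nonneg R} := NngNum (normr_ge0 a).
rewrite (@eq_measure_integral _ _ _ _ (mscale na (pushforward mu
  ((fun x => a * x + b) : measurableTypeR R -> measurableTypeR R)))); last first.
  by move=> A mA _ /=; rewrite -[RHS]/(`|a|%:E * _)%E lebesgue_measure_affine.
rewrite ge0_integral_mscale//= ge0_integral_pushforward//= preimage_setT.
by rewrite ge0_integralZl//; exact: measurableT_comp mf mT.
Qed.

Lemma ge0_integral_normal_prob_scale (a s : R) f : a != 0 -> s != 0 ->
  measurable_fun setT f -> (forall x, 0 <= f x)%E ->
  (\int[normal_prob 0 (`|a| * s)]_x f x = \int[normal_prob 0 s]_x f (a * x)%R)%E.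
Proof.
move=> a0 s0 mf f0.
have mfa : measurable_fun setT (fun x => f (a * x)).
  by apply: measurableT_comp => //; exact: measurable_funM.
rewrite (@ge0_integral_normal_prob 0 s _ mfa (fun=> f0 _)) (@ge0_integral_normal_prob _ _ _ mf f0).
rewrite (@ge0_integral_affine a 0)//; last 2 first.
- apply: emeasurable_funM => //; apply/measurableT_comp => //.
  exact: measurable_normal_pdf.
- by move=> x; rewrite mule_ge0// lee_fin normal_pdf_ge0.
apply: eq_integral => x _; rewrite addr0 muleCA; congr (_ * _)%E.
rewrite -EFinM; congr (_%:E).
have as0 : `|a| * s != 0 by rewrite mulf_neq0// normr_eq0.
rewrite !normal_pdfE//; rewrite mulrA /normal_peak /normal_fun; congr (_ * _).
  rewrite exprMn real_normK ?num_real// -mulrA -mulrnAr sqrtrM ?sqr_ge0//.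
  rewrite sqrtr_sqr invfM mulrA divff ?mul1r// normr_eq0//.
congr expR; rewrite exprMn real_normK ?num_real// !subr0 exprMn.
rewrite -mulrnAr !mulNr; congr (- _).
rewrite invfM mulrACA divff ?mul1r// expf_neq0//.
Qed.


(* Completing the square in [y] of the product density at [((z - b y) / a, y)]. *)
Lemma normal_pdf_rotate (a b s y z : R) : a != 0 -> s != 0 ->
  let r := Num.sqrt (a ^+ 2 + b ^+ 2) in
  normal_pdf 0 s (a^-1 * z - b / a * y) * normal_pdf 0 s y =
  `|a| * normal_pdf 0 (r * s) z * normal_pdf (b * z / r ^+ 2) (`|a| * s / r) y.
Proof.
move=> a0 s0 r.
have a20 : 0 < a ^+ 2 by rewrite exprn_even_gt0.
have r20 : 0 < a ^+ 2 + b ^+ 2 by rewrite ltr_wpDr// sqr_ge0.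
have r0 : 0 < r by rewrite sqrtr_gt0.
have r2E : r ^+ 2 = a ^+ 2 + b ^+ 2 by rewrite sqr_sqrtr// ltW.
have rn0 : r != 0 by rewrite gt_eqF.
have na0 : `|a| != 0 by rewrite normr_eq0.
have na2 : `|a| ^+ 2 = a ^+ 2 by rewrite real_normK ?num_real.
rewrite !normal_pdfE ?mulf_neq0 ?invr_eq0//.
rewrite /normal_peak /normal_fun.
have peakE u : 0 <= u -> Num.sqrt (u ^+ 2 * pi *+ 2) = u * Num.sqrt (pi *+ 2).
  by move=> u0; rewrite -mulrnAr sqrtrM ?sqr_ge0// sqrtr_sqr ger0_norm.
have peakE' u : Num.sqrt (u ^+ 2 * pi *+ 2) = `|u| * Num.sqrt (pi *+ 2).
  by rewrite -[u ^+ 2]real_normK ?num_real// peakE.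
rewrite !peakE' !normrM normfV normr_id (gtr0_norm r0).
set q := Num.sqrt _.
have q0 : q != 0.
  by rewrite gt_eqF// sqrtr_gt0 pmulrn_lgt0// pi_gt0.
have ns0 : `|s| != 0 by rewrite normr_eq0.
rewrite mulrACA -expRD [RHS](_ : _ = (`|a| * (r * `|s| * q)^-1 * (`|a| * `|s| / r * q)^-1) *
  (expR (- (z - 0) ^+ 2 / ((r * s) ^+ 2 *+ 2)) *
  expR (- (y - b * z / r ^+ 2) ^+ 2 / ((`|a| * s / r) ^+ 2 *+ 2)))); last by ring.
congr (_ * _).
  by field; rewrite ?na0 ?rn0 ?q0 ?ns0.
rewrite -expRD; congr expR.
rewrite !exprMn exprVn na2 r2E.
field.
by rewrite a0 s0 gt_eqF.
Qed.

(** The substitution z = a x + b y turns the product density into the density of z times a normal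
    density in y whose mean depends on z. After Tonelli the latter integrates to 1. *)
Lemma integral_normal_rotate (a b s : R) f : s != 0 ->
  measurable_fun setT f -> (forall x, 0 <= f x)%E ->
  (\int[normal_prob 0 s]_y \int[normal_prob 0 s]_x f (a * x + b * y)%R =
   \int[normal_prob 0 s]_x f (Num.sqrt (a ^+ 2 + b ^+ 2) * x)%R)%E.
Proof.
move=> s0 mf f0.
(* The substitution divides by a, so a = 0 is treated by scaling alone. *)
have [->|a0] := eqVneq a 0.
  rewrite (_ : (fun y => _) = fun y => f (b * y)); last first.
    apply/funext => y; under eq_integral do rewrite mul0r add0r.
    rewrite integral_cst//= -[X in (_ * X)%E]/(normal_prob 0 s setT).
    by rewrite probability_setT mule1.
  rewrite expr0n/= add0r sqrtr_sqr.
  have [->|b0] := eqVneq b 0; first by rewrite normr0.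
  have nb0 : `|b| != 0 by rewrite normr_eq0.
  (* Scaling by b and by |b| gives the same centred law, which removes the sign. *)
  rewrite -(@ge0_integral_normal_prob_scale b s f b0 s0 mf f0).
  by rewrite -(@ge0_integral_normal_prob_scale `|b| s f nb0 s0 mf f0) normr_id.
set r := Num.sqrt _.
have r0 : 0 < r.
  by rewrite sqrtr_gt0 ltr_wpDr ?sqr_ge0// exprn_even_gt0.
have rn0 : r != 0 by rewrite gt_eqF.
rewrite -(@ge0_integral_normal_prob_scale r s f rn0 s0 mf f0) (gtr0_norm r0).
have mpdf m t : measurable_fun setT (fun x : R => (normal_pdf m t x)%:E).
  by apply/measurable_EFinP; exact: measurable_normal_pdf.
have E1 y : (\int[normal_prob 0 s]_x f (a * x + b * y)%R =
    \int[mu]_z (`|a|^-1%:E * f z * (normal_pdf 0 s (a^-1 * z - b / a * y))%:E))%E.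
  have mfa : measurable_fun setT (fun x => f (a * x + b * y)).
    by apply: measurableT_comp => //; apply: measurable_funD => //; exact: measurable_funM.
  rewrite (@ge0_integral_normal_prob _ _ _ mfa (fun=> f0 _)).
  rewrite (@ge0_integral_affine a^-1 (- (b / a * y))) ?invr_eq0//; last 2 first.
  - exact: emeasurable_funM.
  - by move=> x; rewrite mule_ge0// lee_fin normal_pdf_ge0.
  apply: eq_integral => z _; rewrite normfV muleA; congr (_ * f _ * _)%E.
  by field.
under eq_integral do rewrite E1.
have mF : measurable_fun setT (fun yz : R * R => `|a|^-1%:E * f yz.2 *
    (normal_pdf 0 s (a^-1 * yz.2 - b / a * yz.1))%:E)%E.
  apply: emeasurable_funM.
    by apply: emeasurable_funM => //; exact: measurableT_comp.
  apply/measurableT_comp => //; apply: measurableT_comp; first exact: measurable_normal_pdf.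
  by apply: measurable_funB; apply: measurable_funM.
have F0 yz : (0 <= `|a|^-1%:E * f yz.2 *
    (normal_pdf 0 s (a^-1 * yz.2 - b / a * yz.1))%:E)%E.
  by rewrite !mule_ge0// lee_fin ?normal_pdf_ge0.
have mG := @measurable_fun_fubini_tonelli_F _ _ _ _ _ mu _ mF F0.
rewrite (@ge0_integral_normal_prob _ _ _ mG); last first.
  by move=> y; exact: integral_ge0.
transitivity (\int[mu]_y \int[mu]_z
   (f z * (normal_pdf 0 (r * s) z)%:E * (normal_pdf (b * z / r ^+ 2) (`|a| * s / r) y)%:E))%E.
  apply: eq_integral => y _.
  rewrite muleC -ge0_integralZl//; last 2 first.
  - exact: measurableT_comp mF _.
  - by rewrite lee_fin normal_pdf_ge0.
  apply: eq_integral => z _ /=.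
  rewrite muleCA -EFinM [(normal_pdf 0 s y * _)%R]mulrC normal_pdf_rotate//.
  rewrite -/r -mulrA EFinM muleACA -EFinM mulVf ?normr_eq0// mul1e.
  by rewrite -muleA EFinM.
rewrite (@fubini_tonelli _ _ _ _ _ mu mu (fun yz => f yz.2 * (normal_pdf 0 (r * s) yz.2)%:E *
   (normal_pdf (b * yz.2 / r ^+ 2) (`|a| * s / r) yz.1)%:E))%E; last 2 first.
- apply: emeasurable_funM.
    apply: emeasurable_funM; first exact: measurableT_comp mf _.
    exact: measurableT_comp (mpdf _ _) _.
  have as0 : `|a| * s / r != 0 by rewrite !mulf_neq0 ?normr_eq0 ?invr_eq0.
  rewrite /normal_pdf (negbTE as0); apply/measurable_EFinP/measurable_funM => //.
  apply: measurableT_comp => //; apply: measurable_funM => //.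
  apply: measurableT_comp => //; apply: measurable_funX; apply: measurable_funB => //.
  by apply: measurable_funM => //; apply: measurable_funM.
- by move=> yz; rewrite !mule_ge0// lee_fin normal_pdf_ge0.
rewrite (@ge0_integral_normal_prob _ _ _ mf f0); apply: eq_integral => z _ /=.
rewrite ge0_integralZl//; last 2 first.
- by move=> y _; rewrite lee_fin normal_pdf_ge0.
- by rewrite mule_ge0// lee_fin normal_pdf_ge0.
by rewrite integral_normal_pdf mule1.
exact: mpdf.
Qed.

End gaussian.

(** * Freezing the past of an independent family *)

(** These events form a pi-system. Independence is given on them only and is carried to the
    sigma-algebra they generate by uniqueness of measures. *)
Definition cylinder {T : Type} {I : eqType} {R : realType} (X : I -> T -> R)
    (J : pred I) : set (set T) :=
  [set A | exists (s : seq I) (B : I -> set R),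
    [/\ {subset s <= J}, forall i, measurable (B i) &
        A = [set w | forall i, i \in s -> B i (X i w)]]].

Section cylinder.
Context {R : realType} {dT : measure_display} {T : measurableType dT}.
Context {I : eqType}.
Variable X : I -> T -> R.
Hypothesis mX : forall i, measurable_fun setT (X i).
Implicit Types J K : pred I.

(* The space [T] equipped with the sigma-algebra generated by the [X i], [i \in J]. *)
Definition past J := g_sigma_algebraType (cylinder X J).
HB.instance Definition _ J := Measurable.on (past J).

Lemma cylinder_bigsetI (s : seq I) (B : I -> set R) :
  [set w | forall i, i \in s -> B i (X i w)] =
  \big[setI/setT]_(i <- s) (X i @^-1` B i).
Proof.
elim: s => [|i s IH]; first by rewrite big_nil; apply/seteqP; split.
rewrite big_cons -IH; apply/seteqP; split => w /=.
  move=> h; split; first by apply: h; rewrite mem_head.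
  by move=> j js; apply: h; rewrite in_cons js orbT.
by move=> [h k] j; rewrite in_cons => /predU1P[->//|]; exact: k.
Qed.

Lemma cylinder_measurable J : cylinder X J `<=` measurable.
Proof.
move=> _ [s [B [_ mB ->]]]; rewrite cylinder_bigsetI.
apply: big_ind => //; first exact: measurableI.
by move=> i _; rewrite -[X in measurable X]setTI; exact: mX.
Qed.

Lemma past_measurable J (A : set T) : measurable (A : set (past J)) -> measurable A.
Proof.
move: A; apply: smallest_sub; first exact: sigma_algebra_measurable.
exact: cylinder_measurable.
Qed.

Lemma cylinder_setI_closed J : setI_closed (cylinder X J).
Proof.
move=> _ _ [s [B [sJ mB ->]]] [t [C [tJ mC ->]]].
exists (s ++ t), (fun i => (if i \in s then B i else setT) `&`
                           (if i \in t then C i else setT)); split.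
- by move=> i; rewrite mem_cat => /orP[/sJ|/tJ].
- by move=> i; apply: measurableI; case: ifP.
- apply/seteqP; split => w /=.
    move=> [h k] i _; split; case: ifPn => //; [exact: h|exact: k].
  move=> h; split => i ip.
    by have := h i; rewrite mem_cat ip => /(_ isT)[].
  by have := h i; rewrite mem_cat ip orbT => /(_ isT)[].
Qed.

Lemma measurable_id_past J : measurable_fun setT (id : T -> past J).
Proof. by move=> _ A mA; rewrite setTI; exact: past_measurable mA. Qed.

Lemma subset_past J K : {subset J <= K} ->
  measurable_fun setT (id : past K -> past J).
Proof.
move=> JK _ A mA; rewrite setTI preimage_id.
move: A mA; apply: smallest_sub; first exact: sigma_algebra_measurable.
move=> _ [s [B [sJ mB ->]]]; apply: sub_sigma_algebra.
by exists s, B; split => // i /sJ /JK.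
Qed.

Lemma measurable_past J i : i \in J -> measurable_fun setT (X i : past J -> R).
Proof.
move=> iJ _ B mB; rewrite setTI; apply: sub_sigma_algebra.
exists [:: i], (fun=> B); split => //.
  by move=> j; rewrite inE => /eqP ->.
apply/seteqP; split => w /=; first by move=> ? j; rewrite inE => /eqP ->.
by apply; rewrite inE.
Qed.

Lemma measurable_past_section J (F : past J * R -> \bar R) (w : T) :
  measurable_fun setT F -> measurable_fun setT (fun y : R => F (w, y)).
Proof. by move=> mF; exact (@measurable_fun_pair2 _ _ _ _ _ _ F w mF). Qed.

Variable P : probability T R.
Hypothesis indep : mutually_independent P X.

(** With B fixed, both sides are finite measures in A that agree on the cylinders over J, by
    independence of finitely many variables. *)
Lemma past_independent J i (A : set T) (B : set R) : i \notin J ->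
  measurable (A : set (past J)) -> measurable B ->
  P (A `&` X i @^-1` B) = (P A * P (X i @^-1` B))%E.
Proof.
move=> iJ mA mB.
have mXB : measurable (X i @^-1` B).
  by rewrite -[X in measurable X]setTI; exact: mX.
have PXB : P (X i @^-1` B) \is a fin_num by exact: fin_num_measure.
pose c : {nonneg R} := NngNum (fine_ge0 (measure_ge0 P (X i @^-1` B))).
rewrite [RHS]muleC -[X in (X * _)%E]fineK//.
apply: (@g_sigma_algebra_measure_unique _ R T (cylinder X J) _ (fun=> setT) _ _
   (mrestr P mXB) (mscale c P)) => //.
- exact: cylinder_measurable.
- move=> _; exists [::], (fun=> setT); split => //.
  by apply/seteqP; split.
- by rewrite bigcup_const//; exists 0%N.
- exact: cylinder_setI_closed.
- move=> _ [s [C [sJ mC ->]]].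
  (* Independence takes a single family of sets and a list without repetitions: B is placed at i,
     which is not in s, and s is replaced by [undup s]. *)
  pose D j := if j == i then B else C j.
  have siN : i \notin undup s.
    by rewrite mem_undup; apply/negP => /sJ; apply/negP.
  have mD j : measurable (D j) by rewrite /D; case: ifP.
  have -> : [set w | forall j, j \in s -> C j (X j w)] =
            [set w | forall j, j \in undup s -> D j (X j w)].
    apply/seteqP; split => w /= h j; rewrite ?mem_undup => js.
      by rewrite /D; case: eqP => [ji|_]; [move: siN; rewrite mem_undup -ji js|exact: h].
    have := h j; rewrite mem_undup => /(_ js); rewrite /D; case: eqP => // ji.
    by move: siN; rewrite mem_undup -ji js.
  have := @indep (i :: undup s) D; rewrite /= siN undup_uniq => /(_ isT mD).
  rewrite !big_cons -(@indep (undup s) D (undup_uniq s) mD) -cylinder_bigsetI /D eqxx.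
  rewrite setIC => E; apply: (etrans E).
  by rewrite -[RHS]/((fine (P (X i @^-1` B)))%:E * P _)%E fineK.
- by move=> _; rewrite /mrestr/= (le_lt_trans (probability_le1 P _)) ?ltry// setTI.
Qed.

(** The joint law of the past and X i agrees with a product measure on rectangles, hence is that
    product; Tonelli does the rest. *)
Lemma integral_past J i (nu : probability (measurableTypeR R) R) (F : past J * R -> \bar R) :
  i \notin J -> (forall B, measurable B -> P (X i @^-1` B) = nu B) ->
  measurable_fun setT F -> (forall z, 0 <= F z)%E ->
  (\int[P]_w F (w, X i w) = \int[P]_w \int[nu]_x F (w, x))%E.
Proof.
move=> iJ Xnu mF F0.
have mid := @measurable_id_past J.
have mpair : measurable_fun setT
    (fun w : T => (w : past J, X i w : measurableTypeR R)).
  by apply: measurable_fun_pair => //; exact: mX.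
pose H : {mfun T >-> past J} := mfun_Sub (mem_set mid).
pose HX : {mfun T >-> (past J * measurableTypeR R)%type} := mfun_Sub (mem_set mpair).
rewrite -[LHS]/(\int[P]_w (F \o HX) w)%E -(ge0_integral_distribution HX mF F0).
have mG := @measurable_fun_fubini_tonelli_F _ _ _ _ _ nu _ mF F0.
have G0 w : (0 <= \int[nu]_x F (w, x))%E by apply: integral_ge0.
rewrite -[RHS]/(\int[P]_w (fubini_F nu F \o H) w)%E -(ge0_integral_distribution H mG G0).
rewrite -(@fubini_tonelli1 _ _ _ _ _ (distribution P H) nu F mF F0).
apply: eq_measure_integral => A mA _; apply/esym.
apply: (@product_measure_unique _ _ _ _ _ (distribution P H) nu (distribution P HX) _ _ mA) => B C mB mC.
rewrite -[RHS]/(P B * nu C)%E -Xnu//.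
by rewrite -[LHS]/(P (B `&` X i @^-1` C)) (past_independent iJ).
Qed.

Lemma past_sub J K (c : T -> R) : {subset J <= K} ->
  measurable_fun setT (c : past J -> R) -> measurable_fun setT (c : past K -> R).
Proof. by move=> JK mc; apply: (measurableT_comp mc); exact: subset_past. Qed.

(* Conditionally on the variables indexed by [J], and on any further ones outside
   [K], the variable [U] has the law of [c * h] where [c] is frozen and [h] is
   distributed under [Q]. *)
Definition cond_law J K (U c : T -> R) {dS : measure_display}
    {S : measurableType dS} (Q : probability S R) (h : S -> R) : Prop :=
  forall J', {subset J <= J'} -> (forall i, i \in K -> i \notin J') ->
  forall F : past J' * R -> \bar R, measurable_fun setT F ->
  (forall z, 0 <= F z)%E ->
  (\int[P]_w F (w, U w) = \int[P]_w \int[Q]_v F (w, c w * h v)%R)%E.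

Lemma cond_law_variable J i (c : T -> R) (nu : probability (measurableTypeR R) R) :
  (forall B, measurable B -> P (X i @^-1` B) = nu B) ->
  measurable_fun setT (c : past J -> R) ->
  cond_law J (pred1 i) (fun w => c w * X i w) c nu id.
Proof.
move=> Xnu mc J' JJ' iJ' F mF F0.
apply: (@integral_past J' i nu (fun z => F (z.1, c z.1 * z.2))) => //.
- by apply: iJ'; rewrite inE.
- apply: (measurableT_comp mF); apply: measurable_fun_pair => //.
  apply: measurable_funM => //.
  by apply: (measurableT_comp (past_sub JJ' mc)).
Qed.

(** U1 is integrated first, over a past enlarged by K2, in which U2 is frozen; then U2 is integrated
    over the original past. This is why [cond_law] must hold for every larger past that avoids K. *)
Lemma integral_cond_lawD J K1 K2 (U1 c1 U2 c2 : T -> R)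
    {dS1 dS2 : measure_display} {S1 : measurableType dS1} {S2 : measurableType dS2}
    (Q1 : probability S1 R) (Q2 : probability S2 R) (h1 : S1 -> R) (h2 : S2 -> R) :
  cond_law J K1 U1 c1 Q1 h1 -> cond_law J K2 U2 c2 Q2 h2 ->
  (forall i, i \in K1 -> i \notin K2) ->
  measurable_fun setT (U2 : past [predU J & K2] -> R) ->
  measurable_fun setT (c1 : past J -> R) ->
  measurable_fun setT h1 ->
  forall J', {subset J <= J'} -> (forall i, i \in [predU K1 & K2] -> i \notin J') ->
  forall F : past J' * R -> \bar R, measurable_fun setT F ->
  (forall z, 0 <= F z)%E ->
  (\int[P]_w F (w, (U1 w + U2 w)%R) =
   \int[P]_w \int[Q2]_y \int[Q1]_x F (w, c1 w * h1 x + c2 w * h2 y)%R)%E.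
Proof.
move=> H1 H2 K12 mU2 mc1 mh1 J' JJ' KJ' F mF F0.
have JJ'2 : {subset [predU J & K2] <= [predU J' & K2]}.
  by move=> i; rewrite !inE => /orP[/JJ' ->//|->]; rewrite orbT.
have J'J'2 : {subset J' <= [predU J' & K2]} by move=> i iJ; rewrite inE/= iJ.
have JJ'2' : {subset J <= [predU J' & K2]} by move=> i /JJ' /J'J'2.
rewrite (H1 [predU J' & K2] JJ'2' _ (fun z => F (z.1, z.2 + U2 z.1))); last 3 first.
- move=> i iK1; rewrite inE/= negb_or; apply/andP; split; last exact: K12.
  by apply: KJ'; rewrite inE/= iK1.
- apply: (measurableT_comp mF); apply: measurable_fun_pair.
    exact: (measurableT_comp (@subset_past J' _ J'J'2) measurable_fst).
  apply: measurable_funD => //.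
  exact: (measurableT_comp (past_sub JJ'2 mU2)).
- by [].
apply: (H2 J' JJ' _ (fun z => \int[Q1]_x F (z.1, c1 z.1 * h1 x + z.2)%R)%E).
- by move=> i iK2; apply: KJ'; rewrite inE/= iK2 orbT.
- apply: (@measurable_fun_fubini_tonelli_F _ _ _ _ _ Q1
    (fun zx : past J' * R * S1 => F (zx.1.1, c1 zx.1.1 * h1 zx.2 + zx.1.2))) => //.
  apply: (measurableT_comp mF); apply: measurable_fun_pair => /=.
    exact: measurableT_comp.
  apply: measurable_funD; last exact: measurableT_comp.
  apply: measurable_funM; last exact: measurableT_comp mh1 _.
  apply: (measurableT_comp (past_sub JJ' mc1)).
  exact: measurableT_comp.
- by move=> z; apply: integral_ge0.
Qed.

End cylinder.

(** * One layer of the network *)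

Lemma measurable_sqrt {R : realType} : measurable_fun setT (@Num.sqrt R).
Proof. exact: (continuous_measurable_fun (@sqrt_continuous R)). Qed.

Lemma integral_probability_cst {R : realType} {dT : measure_display}
    {T : measurableType dT} (P : probability T R) (c : \bar R) :
  (\int[P]_w c = c)%E.
Proof. by rewrite integral_cst//= -[X in (_ * X)%E]/(P setT) probability_setT mule1. Qed.

Section prelu.
Context {R : realType}.
Variable a : R.

Lemma measurable_prelu : measurable_fun setT (prelu a).
Proof.
rewrite /prelu; apply: measurable_fun_ifT.
- exact: measurable_fun_ltr.
- exact: measurable_id.
- exact: measurable_funM.
Qed.

Lemma measurable_prelu_sqr : measurable_fun setT (fun z => prelu a z ^+ 2).
Proof. by apply: measurable_funX; exact: measurable_prelu. Qed.

Lemma preluM (c z : R) : 0 <= c -> prelu a (c * z) = c * prelu a z.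
Proof.
rewrite le_eqVlt => /predU1P[<-|c0]; first by rewrite !mul0r /prelu ltxx mulr0.
by rewrite /prelu pmulr_rgt0//; case: ifP => // _; rewrite mulrCA.
Qed.

End prelu.

Section gaussian_cond_law.
Context {R : realType} {dT : measure_display} {T : measurableType dT}.
Variable P : probability T R.

Section row.
Context {I A : eqType}.
Variables (X : I -> T -> R) (sigma : R).
Hypotheses (sigma0 : 0 < sigma) (iidX : iid_gaussian P X sigma).

Let mX : forall i, measurable_fun setT (X i). Proof. by have [] := iidX. Qed.
Let lawX i (B : set R) : measurable B -> P (X i @^-1` B) = normal_prob 0 sigma B.
Proof. by have [_ h _] := iidX; exact: h. Qed.
Let indX : mutually_independent P X. Proof. by have [] := iidX. Qed.

(** Each new entry contributes an independent Gaussian with a frozen coefficient, and the planar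
    rotation merges it with the sum so far: the coefficients combine to the root of the sum of their
    squares. *)
Lemma cond_law_linear (J : pred I) (x : A -> T -> R) (e : A -> I) (s : seq A) :
  uniq (map e s) -> (forall j, measurable_fun setT (x j : past X J -> R)) ->
  cond_law X P J (mem (map e s)) (fun w => \sum_(j <- s) x j w * X (e j) w)
    (fun w => Num.sqrt (\sum_(j <- s) x j w ^+ 2)) (normal_prob 0 sigma) id.
Proof.
move=> + mx; elim: s => [_|j s IH /= /andP[ejs us]].
  move=> J' _ _ F mF F0; apply: eq_integral => w _.
  under [RHS]eq_integral do rewrite big_nil sqrtr0 mul0r.
  by rewrite big_nil integral_probability_cst.
have mc : measurable_fun setT
    ((fun w => Num.sqrt (\sum_(j <- s) x j w ^+ 2)) : past X J -> R).
  apply: (measurableT_comp measurable_sqrt); apply: measurable_sum => i.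
  by apply: measurable_funX; exact: mx.
move=> J' JJ' KJ' F mF F0.
under eq_integral do rewrite big_cons addrC.
rewrite (integral_cond_lawD (IH us)
  (cond_law_variable mX indX (lawX (e j)) (mx j)) _ _ mc _ JJ' _ mF F0).
- apply: eq_integral => w _.
  have mFw : measurable_fun setT (fun y : R => F (w, y)) by exact: measurable_past_section.
  rewrite (@integral_normal_rotate R _ _ sigma (fun y => F (w, y)) _ mFw) ?gt_eqF//.
  rewrite sqr_sqrtr; last by apply: sumr_ge0 => i _; rewrite sqr_ge0.
  by under [RHS]eq_integral do rewrite big_cons addrC.
- by move=> i ies; rewrite inE; apply: contra ejs => /eqP <-.
- apply: measurable_funM.
    by apply: past_sub (mx j) => i iJ; rewrite inE/= iJ.
  by apply: measurable_past; rewrite !inE eqxx orbT.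
- exact: measurable_id.
- move=> i ie; apply: KJ'; move: ie; rewrite !inE => /orP[|->//].
  by move=> ->; rewrite orbT.
Qed.

(** [prelu] is positively homogeneous, so the nonnegative factor sigma c comes out of it and leaves
    a standard Gaussian. *)
Lemma cond_law_prelu_sqr (a : R) (J K : pred I) (U c : T -> R) :
  (forall w, 0 <= c w) ->
  cond_law X P J K U c (normal_prob 0 sigma) id ->
  cond_law X P J K (fun w => prelu a (U w) ^+ 2) (fun w => (sigma * c w) ^+ 2)
    (normal_prob 0 1) (fun z => prelu a z ^+ 2).
Proof.
move=> c0 HU J' JJ' KJ' F mF F0.
have mp := measurable_prelu_sqr a.
rewrite (HU J' JJ' KJ' (fun z => F (z.1, prelu a z.2 ^+ 2))); last 2 first.
- by apply: (measurableT_comp mF); apply: measurable_fun_pair => //; exact: (measurableT_comp mp measurable_snd).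
- by [].
apply: eq_integral => w _ /=.
have mFw : measurable_fun setT (fun y => F (w, prelu a (c w * y) ^+ 2)).
  apply: (@measurableT_comp _ _ _ _ _ _ (fun y => F (w, y))); first exact: measurable_past_section.
  by apply: (measurableT_comp mp); exact: measurable_funM.
have := @ge0_integral_normal_prob_scale R sigma 1
  (fun y => F (w, prelu a (c w * y) ^+ 2)) (lt0r_neq0 sigma0) (oner_neq0 _) mFw (fun=> F0 _).
rewrite mulr1 (gtr0_norm sigma0) => ->.
apply: eq_integral => y _; rewrite mulrA (mulrC _ sigma).
by rewrite preluM ?exprMn// mulr_ge0// ltW.
Qed.

End row.

Lemma cond_law_sum {I A : eqType} (X : I -> T -> R)
    (mX : forall i, measurable_fun setT (X i))
    (Z : A -> T -> R) (J : pred I) (K : A -> pred I) (Y : A -> T -> R) (c : T -> R)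
    (h : R -> R) (s : seq A) :
  iid_gaussian P Z 1 -> measurable_fun setT h ->
  measurable_fun setT (c : past X J -> R) ->
  (forall i, measurable_fun setT (Y i : past X [predU J & K i] -> R)) ->
  (forall i j t, i != j -> t \in K i -> t \notin K j) ->
  (forall i, cond_law X P J (K i) (Y i) c (normal_prob 0 1) h) ->
  uniq s ->
  cond_law X P J [pred t | has (fun i => t \in K i) s]
    (fun w => \sum_(i <- s) Y i w) c P (fun v => \sum_(i <- s) h (Z i v)).
Proof.
move=> [mZ lawZ indZ] mh mc mY KK HY.
have mhZ i : measurable_fun setT (fun v => h (Z i v)) by exact: measurableT_comp.
elim: s => [_|i s IH /= /andP[si us]].
  move=> J' _ _ F mF F0; apply: eq_integral => w _.
  under [RHS]eq_integral do rewrite big_nil mulr0.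
  by rewrite big_nil integral_probability_cst.
move=> J' JJ' KJ' F mF F0.
under eq_integral do rewrite big_cons addrC.
rewrite (integral_cond_lawD (IH us) (HY i) _ (mY i) mc _ JJ' _ mF F0).
- apply: eq_integral => w _.
  have mG : measurable_fun setT
     (fun z : past Z (mem s) * R => F (w, c w * (h z.2 + \sum_(j <- s) h (Z j z.1)))).
    apply: (@measurableT_comp _ _ _ _ _ _ (fun y => F (w, y))); first exact: measurable_past_section.
    apply: measurable_funM => //; apply: measurable_funD; first exact: (measurableT_comp mh measurable_snd).
    under eq_fun do rewrite big_seq big_mkcond /=.
    apply: measurable_sum => j; case: (boolP (j \in s)) => js //.
    have mj : measurable_fun setT (Z j : past Z (mem s) -> R) by exact: measurable_past.
    exact: (measurableT_comp mh (measurableT_comp mj measurable_fst)).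
  under [RHS]eq_integral do rewrite big_cons.
  (* On the side of Z the new variable is likewise separated from those already in the sum, so that
     both sides become double integrals. *)
  rewrite (@integral_past _ _ _ _ Z mZ P indZ (mem s) i (normal_prob 0 1)
    (fun z => F (w, c w * (h z.2 + \sum_(j <- s) h (Z j z.1)))) si (lawZ i) mG (fun=> F0 _)).
  have mH : measurable_fun setT
     (fun z : T * R => F (w, c w * (h z.2 + \sum_(j <- s) h (Z j z.1)))).
    apply: (@measurableT_comp _ _ _ _ _ _ (fun y => F (w, y))); first exact: measurable_past_section.
    apply: measurable_funM => //; apply: measurable_funD; first exact: (measurableT_comp mh measurable_snd).
    by apply: measurable_sum => j; exact: (measurableT_comp (mhZ j) measurable_fst).
  rewrite (@fubini_tonelli _ _ _ _ _ P (normal_prob 0 1)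
    (fun z => F (w, c w * (h z.2 + \sum_(j <- s) h (Z j z.1)))) mH (fun=> F0 _)).
  apply: eq_integral => y _; apply: eq_integral => v _; do 2 f_equal.
  by rewrite mulrDr addrC.
- move=> t /hasP[j js tj]; apply: KK tj.
  by apply: contraNneq si => <-.
- exact: measurable_sum.
- move=> t; rewrite !inE => /orP[h1|h1]; apply: KJ'; rewrite !inE/=; apply/orP; by [right|left].
Qed.

End gaussian_cond_law.

Section layers.
Context {R : realType} {dT : measure_display} {T : measurableType dT}.
Variables (P : probability T R) (d : nat) (a sigma : R) (x0 : 'cV[R]_d).
Variables (W : nat -> T -> 'M[R]_d) (Zs : 'I_d -> T -> R).

Let X (t : nat * 'I_d * 'I_d) (w : T) : R := W t.1.1 w t.1.2 t.2.
Let V (v : T) : R := enorm (prelu_vec a (\col_i Zs i v)).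

Hypotheses (sigma0 : 0 < sigma) (iidX : iid_gaussian P X sigma).
Hypothesis iidZ : iid_gaussian P Zs 1.

Let mX : forall i, measurable_fun setT (X i). Proof. by have [] := iidX. Qed.

Let before (k : nat) : pred (nat * 'I_d * 'I_d) := [pred t | (t.1.1 < k)%N].

Lemma layersS k w i : layers a x0 W k.+1 w i 0 =
  prelu a (\sum_j layers a x0 W k w j 0 * X (k, i, j) w).
Proof.
by rewrite /= !mxE; congr (prelu a _); apply: eq_bigr => j _; rewrite mulrC.
Qed.

(** Matrices are indexed from 0 and [W k] produces layer k.+1, so layer k depends on the indices
    below k only and the entries of [W k] are fresh for it. *)
Lemma measurable_layers k i :
  measurable_fun setT ((fun w => layers a x0 W k w i 0) : past X (before k) -> R).
Proof.
elim: k i => [|k IH] i; first exact: measurable_cst.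
under eq_fun do rewrite layersS.
apply: (measurableT_comp (measurable_prelu a)); apply: measurable_sum => j.
apply: measurable_funM; last by apply: measurable_past; rewrite inE/=.
by apply: past_sub (IH j) => t; rewrite !inE => /ltn_trans; apply.
Qed.

Lemma measurable_enorm_layers_past k :
  measurable_fun setT ((fun w => enorm (layers a x0 W k w)) : past X (before k) -> R).
Proof.
apply: (measurableT_comp measurable_sqrt); apply: measurable_sum => i.
by apply: measurable_funX; exact: measurable_layers.
Qed.

Lemma measurable_enorm_layers k : measurable_fun setT (fun w => enorm (layers a x0 W k w)).
Proof.
by apply: (measurableT_comp (@measurable_enorm_layers_past k)); exact: measurable_id_past.
Qed.

Lemma enorm_prelu_sqr (v : 'cV[R]_d) :
  enorm (prelu_vec a v) = Num.sqrt (\sum_i prelu a (v i 0) ^+ 2).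
Proof. by congr Num.sqrt; apply: eq_bigr => i _; rewrite mxE. Qed.

(** Given the first k matrices, the coordinates of the next layer come from disjoint rows and all
    have scale sigma |x_k|. Their squares add up to (sigma |x_k|)^2 times a copy of V^2; testing
    with f after the square root returns to norms. *)
Lemma integral_enorm_layersS k (f : R -> \bar R) :
  measurable_fun setT f -> (forall x, 0 <= f x)%E ->
  (\int[P]_w f (enorm (layers a x0 W k.+1 w)) =
   \int[P]_w \int[P]_v f (sigma * enorm (layers a x0 W k w) * V v)%R)%E.
Proof.
move=> mf f0.
pose J := before k.
pose row i : pred (nat * 'I_d * 'I_d) := mem (map (fun j => (k, i, j)) (index_enum 'I_d)).
have rowP i t : t \in row i -> t.1 = (k, i).
  by rewrite inE => /mapP[j _ ->].
pose Y i w := prelu a (\sum_j layers a x0 W k w j 0 * X (k, i, j) w) ^+ 2.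
have H i : cond_law X P J (row i) (Y i)
    (fun w => (sigma * enorm (layers a x0 W k w)) ^+ 2) (normal_prob 0 1)
    (fun z => prelu a z ^+ 2).
  apply: (cond_law_prelu_sqr sigma0); first by move=> w; exact: sqrtr_ge0.
  apply: (cond_law_linear sigma0 iidX).
    by rewrite map_inj_uniq ?index_enum_uniq// => j j' [].
  by move=> j; exact: measurable_layers.
have mc : measurable_fun setT
    ((fun w => (sigma * enorm (layers a x0 W k w)) ^+ 2) : past X J -> R).
  apply: measurable_funX; apply: measurable_funM => //.
  exact: measurable_enorm_layers_past.
have mY i : measurable_fun setT (Y i : past X [predU J & row i] -> R).
  apply: (measurableT_comp (measurable_prelu_sqr a)); apply: measurable_sum => j.
  apply: measurable_funM.
    by apply: past_sub (@measurable_layers k j) => t tJ; rewrite inE/= tJ.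
  apply: measurable_past; rewrite inE/=; apply/orP; right.
  by apply/mapP; exists j => //; rewrite mem_index_enum.
have RR i j t : i != j -> t \in row i -> t \notin row j.
  move=> ij /rowP ti; apply/negP => /rowP; rewrite ti => -[] /eqP.
  by rewrite (negbTE ij).
have := @cond_law_sum _ _ _ P _ _ X mX Zs J row Y _ _ (index_enum 'I_d) iidZ
  (measurable_prelu_sqr a) mc mY RR H (index_enum_uniq _).
have msq : measurable_fun setT (fun z : past X J * R => f (Num.sqrt z.2)).
  exact: (measurableT_comp mf (measurableT_comp measurable_sqrt measurable_snd)).
move=> /(_ J (fun _ => id) _ (fun z => f (Num.sqrt z.2)) msq (fun=> f0 _)) => HH.
transitivity (\int[P]_w f (Num.sqrt (\sum_i Y i w)))%E.
  apply: eq_integral => w _; congr (f (Num.sqrt _)).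
  by apply: eq_bigr => i _; rewrite layersS.
rewrite HH; last first.
  move=> t /hasP[i _ /rowP ti]; rewrite /J /before inE/= ti/=.
  by rewrite ltnn.
apply: eq_integral => w _; apply: eq_integral => v _ /=.
congr f; rewrite /V enorm_prelu_sqr sqrtrM ?sqr_ge0// sqrtr_sqr ger0_norm; last first.
  by rewrite mulr_ge0 ?sqrtr_ge0// ltW.
by congr (_ * Num.sqrt _); apply: eq_bigr => i _; rewrite mxE.
Qed.

End layers.

(** * Geometric decay of multiplicative functionals *)

Lemma nneseries_geometric_lty {R : realType} (c r : R) : `|r| < 1 ->
  (\sum_(0 <= k <oo) (c * r ^+ k)%:E < +oo)%E.
Proof.
move=> r1; suff -> : (\sum_(0 <= k <oo) (c * r ^+ k)%:E = (c / (1 - r))%:E)%E.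
  by rewrite ltry.
apply/cvg_lim => //.
rewrite (_ : (fun n : nat => _) = EFin \o series (geometric c r)); last first.
  by apply/funext => n /=; rewrite -sumEFin.
by apply: cvg_EFin; [exact: nearW|exact: cvg_geometric_series].
Qed.

Lemma ae_cvg0_of_integral_geometric {R : realType} {dT : measure_display}
    {T : measurableType dT} (P : probability T R) (f : nat -> T -> R) (c r : R) :
  (forall k, measurable_fun setT (f k)) -> (forall k w, 0 <= f k w) ->
  (forall k, \int[P]_w (f k w)%:E = (c * r ^+ k)%:E)%E -> `|r| < 1 ->
  {ae P, forall w, f k w @[k --> \oo] --> 0}.
Proof.
move=> mf f0 intf r1.
have mfE k : measurable_fun setT (fun w => (f k w)%:E) by exact/measurable_EFinP.
have intS : P.-integrable setT (fun w => \sum_(0 <= k <oo) (f k w)%:E)%E.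
  apply/integrableP; split.
    by apply: ge0_emeasurable_sum => // k w _ _; rewrite lee_fin.
  have S0 w : (0 <= \sum_(0 <= k <oo) (f k w)%:E)%E.
    by apply: nneseries_ge0 => k _ _; rewrite lee_fin.
  under eq_integral do rewrite (gee0_abs (S0 _)).
  rewrite integral_nneseries//; last by move=> k w _; rewrite lee_fin.
  by under eq_eseriesr do rewrite intf; exact: nneseries_geometric_lty.
have := integrable_ae measurableT intS.
apply: filterS => w /(_ I) fin.
apply: (@cvg_series_cvg_0 _ R^o); apply: nnseries_is_cvg => //.
by rewrite ltey_eq fin.
Qed.

Lemma measurable_enorm_prelu {R : realType} {dT : measure_display}
    {T : measurableType dT} (d : nat) (a : R) (Zs : 'I_d -> T -> R) :
  (forall i, measurable_fun setT (Zs i)) ->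
  measurable_fun setT (fun v => enorm (prelu_vec a (\col_i Zs i v))).
Proof.
move=> mZ; apply: (measurableT_comp measurable_sqrt); apply: measurable_sum => i.
under eq_fun do rewrite !mxE.
exact: (measurableT_comp (measurable_prelu_sqr a)).
Qed.

Section multiplicative.
Context {R : realType} {dT : measure_display} {T : measurableType dT}.
Variables (P : probability T R) (d : nat) (a sigma : R) (x0 : 'cV[R]_d).
Variables (W : nat -> T -> 'M[R]_d) (Zs : 'I_d -> T -> R).
Hypotheses (sigma0 : 0 < sigma).
Hypothesis iidW :
  iid_gaussian P (fun t : nat * 'I_d * 'I_d => fun w => W t.1.1 w t.1.2 t.2) sigma.
Hypothesis iidZ : iid_gaussian P Zs 1.
Variables (g : R -> R) (r : R).
Hypotheses (mg : measurable_fun setT g) (g0 : forall x, 0 <= g x).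
Hypothesis gM : forall x y, 0 <= x -> 0 <= y -> g (x * y) = g x * g y.
Hypothesis intg :
  (\int[P]_v (g (sigma * enorm (prelu_vec a (\col_i Zs i v))))%:E = r%:E)%E.

(** Multiplicativity of g is required on nonnegative arguments only, where real powers have it;
    norms stay in that range. *)
Lemma integral_multiplicative_layers k :
  (\int[P]_w (g (enorm (layers a x0 W k w)))%:E = (g (enorm x0) * r ^+ k)%:E)%E.
Proof.
elim: k => [|k IH]; first by rewrite /= integral_probability_cst expr0 mulr1.
have mgE : measurable_fun setT (EFin \o g) by exact/measurable_EFinP.
have gE0 x : (0 <= (EFin \o g) x)%E by rewrite lee_fin.
have mL := measurable_enorm_layers a x0 iidW k.
rewrite (integral_enorm_layersS a x0 sigma0 iidW iidZ k mgE gE0).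
transitivity (\int[P]_w ((g (enorm (layers a x0 W k w)))%:E * r%:E))%E.
  apply: eq_integral => w _; rewrite -intg -ge0_integralZl//.
  - apply: eq_integral => v _ /=; rewrite -EFinM -gM ?sqrtr_ge0//.
      by rewrite mulrA (mulrC _ sigma).
    by rewrite mulr_ge0 ?sqrtr_ge0// ltW.
  - apply: (measurableT_comp mgE); apply: measurable_funM => //.
    by apply: measurable_enorm_prelu; have [] := iidZ.
  - by move=> v _; rewrite lee_fin.
  - by rewrite lee_fin.
rewrite ge0_integralZr//.
- by rewrite IH -EFinM exprSr mulrA.
- exact: measurableT_comp mgE mL.
- by move=> v _; rewrite lee_fin.
- by rewrite -intg; apply: integral_ge0 => v _; rewrite lee_fin.
Qed.


Lemma ae_multiplicative_layers_cvg0 : r < 1 ->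
  {ae P, forall w, g (enorm (layers a x0 W k w)) @[k --> \oo] --> 0}.
Proof.
move=> r1; apply: (ae_cvg0_of_integral_geometric _ _ integral_multiplicative_layers).
- by move=> k; exact: measurableT_comp mg (measurable_enorm_layers a x0 iidW k).
- by [].
- rewrite ger0_norm// -lee_fin -intg; apply: integral_ge0 => v _.
  by rewrite lee_fin.
Qed.

End multiplicative.

(** * Exponential moments *)

Section expR_bounds.
Context {R : realType}.
Implicit Types x y t v : R.

Lemma normr_le_expR (q y : R) : 0 < q -> `|y| <= q^-1 * (expR (q * y) + expR (- q * y)).
Proof.
move=> q0; rewrite -ler_pdivrMl ?invr_gt0// invrK.
have h1 := expR_ge1Dx (q * y); have h2 := expR_ge1Dx (- q * y).
have p1 := expR_gt0 (q * y); have p2 := expR_gt0 (- q * y).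
have := mulrN q y; rewrite -mulNr => e.
have [y0|y0] := ger0P y; first by lra.
by rewrite mulrN; lra.
Qed.

(** From 1 - v <= e^(-v) one gets e^v - 1 <= v e^v, hence e^v - 1 - v <= v (e^v - 1). The last
    factor is bounded by v e^v from above if v >= 0 and by v from below if v < 0. *)
Lemma expR_le_quadratic v : expR v <= 1 + v + v ^+ 2 * expR `|v|.
Proof.
have h : expR v - 1 <= v * expR v.
  have h1 := expR_ge1Dx (- v); have pv := expR_gt0 v.
  have vv : expR v * expR (- v) = 1 by rewrite -expRD subrr expR0.
  by nra.
have h2 := expR_ge1Dx v.
have [v0|v0] := ger0P v; first by nra.
have h3 : 1 <= expR (- v) by rewrite -expR0 ler_expR; lra.
have h4 := sqr_ge0 v.
by nra.
Qed.

(** The coefficient of t^2 is free of t, so integration gives a uniform second-order bound near 0.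
    The exponent u is shared in halves: t takes one, and the factor y^2 is absorbed by the other.
    Squaring u |y| / 4 <= e^(u |y| / 4) produces the constant 16. *)
Lemma expR_le_quadratic_cosh (t u y : R) : 0 < u -> 0 <= t <= u / 2 ->
  expR (t * y) <= 1 + t * y + t ^+ 2 * (16 / u ^+ 2 * (expR (u * y) + expR (- u * y))).
Proof.
move=> u0 /andP[t0 tu]; apply: (le_trans (expR_le_quadratic _)).
rewrite lerD2l exprMn -[leLHS]mulrA; apply: ler_wpM2l; first exact: sqr_ge0.
rewrite normrM (ger0_norm t0).
have ny : 0 <= `|y| by [].
have uu : 0 <= 16 / u ^+ 2 by rewrite divr_ge0 ?sqr_ge0.
apply: (@le_trans _ _ (16 / u ^+ 2 * expR (u * `|y|))); last first.
  rewrite ler_wpM2l //.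
  have p1 := expR_ge0 (u * y); have p2 := expR_ge0 (- u * y).
  have [y0|y0] := ger0P y; first by rewrite lerDl.
  by rewrite mulrN -mulNr lerDr.
have h : y ^+ 2 <= 16 / u ^+ 2 * expR (u / 2 * `|y|).
  have := expR_ge1Dx (u / 4 * `|y|) => h.
  have e2 : expR (u / 2 * `|y|) = expR (u / 4 * `|y|) ^+ 2.
    by rewrite expr2 -expRD; congr expR; field.
  rewrite e2 -[y ^+ 2]real_normK ?num_real//.
  have h' : u / 4 * `|y| <= expR (u / 4 * `|y|) by lra.
  have h'' : (u / 4 * `|y|) ^+ 2 <= expR (u / 4 * `|y|) ^+ 2.
    have u40 : 0 <= u / 4 by lra.
    by rewrite ler_sqr ?nnegrE ?expR_ge0//; apply: mulr_ge0.
  apply: le_trans (_ : 16 / u ^+ 2 * (u / 4 * `|y|) ^+ 2 <= _); last first.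
    by rewrite ler_wpM2l.
  rewrite le_eqVlt; apply/orP; left; apply/eqP; field.
  by rewrite gt_eqF.
apply: (@le_trans _ _ (16 / u ^+ 2 * expR (u / 2 * `|y|) * expR (t * `|y|))).
  by rewrite ler_wpM2r ?expR_ge0.
rewrite -mulrA -expRD ler_wpM2l // ler_expR -mulrDl ler_wpM2r//.
by lra.
Qed.

(** This is the chord of t -> e^(t y) over [0, s]. After division by e^(p y), the tangent bounds 1 +
    x < e^x at x = - p y and x = (s - p) y, weighted by s - p and p, have linear terms that
    cancel. *)
Lemma expR_interpolation (p s y : R) : 0 < p < s -> y != 0 ->
  expR (p * y) < 1 + p / s * (expR (s * y) - 1).
Proof.
move=> /andP[p0 ps] y0; have s0 : 0 < s by exact: lt_trans ps.
have ns : s != 0 by rewrite gt_eqF.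
have h1 : 1 + - (p * y) < expR (- (p * y)).
  by apply: expR_gt1Dx; rewrite oppr_eq0 mulf_neq0// gt_eqF.
have h2 : 1 + (s - p) * y < expR ((s - p) * y).
  by apply: expR_gt1Dx; rewrite mulf_neq0// subr_eq0 gt_eqF.
have e1 : expR (p * y) * expR (- (p * y)) = 1 by rewrite -expRD subrr expR0.
have e2 : expR (p * y) * expR ((s - p) * y) = expR (s * y).
  by rewrite -expRD; congr expR; ring.
have P := expR_gt0 (p * y).
have key : s < (s - p) * expR (- (p * y)) + p * expR ((s - p) * y) by nra.
rewrite -(ltr_pM2l s0) [ltRHS](_ : _ = s + p * (expR (s * y) - 1)); last by field.
have {}key : expR (p * y) * s <
    expR (p * y) * ((s - p) * expR (- (p * y)) + p * expR ((s - p) * y)).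
  by rewrite ltr_pM2l.
rewrite [ltLHS]mulrC; apply: lt_le_trans key _; rewrite mulrDr !(mulrCA (expR _)) e1 e2; lra.
Qed.

Lemma expR_interpolation_le (p s y : R) : 0 < p < s ->
  expR (p * y) <= 1 + p / s * (expR (s * y) - 1).
Proof.
move=> ps; have [->|/(expR_interpolation ps)/ltW//] := eqVneq y 0.
by rewrite !mulr0 expR0 subrr mulr0 addr0.
Qed.

End expR_bounds.

Section exp_moments.
Context {R : realType} {dT : measure_display} {T : measurableType dT}.
Variable P : probability T R.
Implicit Types (f g Y : T -> R).

Lemma integrable_probability_cst (c : R) : P.-integrable setT (EFin \o (fun=> c)).
Proof. exact: finite_measure_integrable_cst. Qed.

Lemma Rintegral_probability_cst (c : R) : \int[P]_w c = c.
Proof.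
by rewrite Rintegral_cst//= -[X in fine X]/(P setT) probability_setT mulr1.
Qed.

Lemma measurable_lt f g : measurable_fun setT f -> measurable_fun setT g ->
  measurable [set w | f w < g w].
Proof.
move=> mf mg; have h := measurable_fun_ltr mf mg.
by have := @h measurableT [set true] I; rewrite setTI.
Qed.

(** If the integrals were equal, the nonnegative g - f would have integral 0 and so vanish almost
    everywhere. *)
Lemma lt_Rintegral f g : P.-integrable setT (EFin \o f) ->
  P.-integrable setT (EFin \o g) -> (forall w, f w <= g w) ->
  P [set w | f w < g w] != 0%E -> \int[P]_w f w < \int[P]_w g w.
Proof.
move=> intf intg fg P0.
have [//|gf] := ltP; exfalso; move/eqP: P0; apply.
have fgI : \int[P]_w f w = \int[P]_w g w.
  by apply/eqP; rewrite eq_le gf le_Rintegral.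
have intgf : P.-integrable setT (EFin \o (fun w => g w - f w)).
  exact: (integrableB measurableT intg intf).
have I0 : (\int[P]_w `|(g w - f w)%:E| = 0)%E.
  rewrite (eq_integral (fun w => (g w - f w)%:E)); last first.
    by move=> w _; rewrite gee0_abs// lee_fin subr_ge0.
  rewrite -[LHS]fineK; last exact: integrable_fin_num intgf.
  by rewrite -[fine _]/(\int[P]_w (g w - f w)) RintegralB// fgI subrr.
have /(ae_eq_integral_abs P measurableT)[h _] : measurable_fun setT (fun w => (g w - f w)%:E).
  exact: measurable_int intgf.
have [N [mN PN0 subN]] := h I0.
apply/eqP; rewrite eq_le measure_ge0 andbT -PN0; apply: le_measure; rewrite ?inE//.
  apply: measurable_lt; apply/measurable_EFinP; first exact: (measurable_int P intf).
  exact: (measurable_int P intg).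
apply: subset_trans subN => w /= fgw; apply/not_implyP; split => //.
by move/eqP; rewrite eqe subr_eq0 => /eqP e; move: fgw; rewrite e ltxx.
Qed.

Lemma integrable_EFinD f g : P.-integrable setT (EFin \o f) ->
  P.-integrable setT (EFin \o g) -> P.-integrable setT (EFin \o (fun w => f w + g w)).
Proof. exact: integrableD. Qed.

Lemma integrable_EFinZl (c : R) f : P.-integrable setT (EFin \o f) ->
  P.-integrable setT (EFin \o (fun w => c * f w)).
Proof. exact: integrableZl. Qed.

Lemma dominated_integrable f g : measurable_fun setT f ->
  (forall w, `|f w| <= g w) -> P.-integrable setT (EFin \o g) ->
  P.-integrable setT (EFin \o f).
Proof.
move=> mf fg; apply: le_integrable => //; first exact/measurable_EFinP.
by move=> w _; rewrite /= lee_fin (le_trans (fg w))// ler_norm.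
Qed.

Lemma measurable_expRM (t : R) Y : measurable_fun setT Y ->
  measurable_fun setT (fun w => expR (t * Y w)).
Proof. by move=> mY; apply: measurableT_comp => //; exact: measurable_funM. Qed.

Section two_sided.
Variables (Y : T -> R) (q : R).
Hypotheses (q0 : 0 < q) (mY : measurable_fun setT Y).
Hypothesis intq : P.-integrable setT (EFin \o (fun w => expR (q * Y w))).
Hypothesis intNq : P.-integrable setT (EFin \o (fun w => expR (- q * Y w))).

Let cosh w := expR (q * Y w) + expR (- q * Y w).

Let intcosh : P.-integrable setT (EFin \o cosh).
Proof. exact: integrable_EFinD. Qed.

Lemma integrable_two_sided : P.-integrable setT (EFin \o Y).
Proof.
apply: (dominated_integrable mY _ (integrable_EFinZl q^-1 intcosh)) => w.
exact: normr_le_expR.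
Qed.

Lemma integrable_expRM_between (t : R) : `|t| <= q ->
  P.-integrable setT (EFin \o (fun w => expR (t * Y w))).
Proof.
move=> tq; apply: (dominated_integrable (measurable_expRM t mY) _ intcosh) => w.
rewrite ger0_norm ?expR_ge0// /cosh; apply: (@le_trans _ _ (expR (q * `|Y w|))).
  rewrite ler_expR (le_trans (ler_norm _))// normrM; exact: ler_wpM2r.
have p1 := expR_ge0 (q * Y w); have p2 := expR_ge0 (- q * Y w).
have [y0|y0] := ger0P (Y w); first by rewrite lerDl.
by rewrite mulrN -mulNr lerDr.
Qed.

(** Differentiating psi at 0 is avoided: the uniform quadratic bound integrates to psi t <= 1 + t m
    + t^2 K, where the negative linear term wins for small t. *)
Lemma exp_moment_lt1 : \int[P]_w Y w < 0 ->
  exists2 t, 0 < t <= q & \int[P]_w expR (t * Y w) < 1.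
Proof.
set m := \int[P]_w Y w => m0.
pose K := \int[P]_w (16 / q ^+ 2 * cosh w).
have intK : P.-integrable setT (EFin \o (fun w => 16 / q ^+ 2 * cosh w)).
  exact: integrable_EFinZl.
have K0 : 0 <= K.
  apply: Rintegral_ge0 => w _; rewrite mulr_ge0 ?divr_ge0 ?sqr_ge0//.
  by rewrite addr_ge0 ?expR_ge0.
(* The first entry keeps t in the range of the quadratic bound; the second gives t K < t (K + 1) <=
   - m. Using K + 1 yields strictness and a positive denominator. *)
pose t := Num.min (q / 2) (- m / (K + 1)).
have q20 : 0 < q / 2 by rewrite divr_gt0.
have K1 : 0 < K + 1 by rewrite ltr_wpDl.
have t0 : 0 < t by rewrite lt_min q20/= divr_gt0// oppr_gt0.
have tq2 : t <= q / 2 by rewrite ge_min lexx.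
have tq : t <= q by rewrite (le_trans tq2)// ler_pdivrMr// ler_peMr// ?ler1n// ltW.
exists t; first by rewrite t0.
have intt : P.-integrable setT (EFin \o (fun w => expR (t * Y w))).
  by apply: integrable_expRM_between; rewrite gtr0_norm.
have int1 := integrable_EFinD (integrable_probability_cst 1)
  (integrable_EFinZl t integrable_two_sided).
have int2 := integrable_EFinZl (t ^+ 2) intK.
apply: (@le_lt_trans _ _ (1 + t * m + t ^+ 2 * K)).
  have <- : \int[P]_w (1 + t * Y w + t ^+ 2 * (16 / q ^+ 2 * cosh w)) = 1 + t * m + t ^+ 2 * K.
    rewrite RintegralD// RintegralD//; last exact: (integrable_EFinZl t integrable_two_sided).
      rewrite Rintegral_probability_cst (RintegralZl _ measurableT integrable_two_sided).
      by rewrite (RintegralZl _ measurableT intK).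
    exact: integrable_probability_cst.
  apply: le_Rintegral => //; first exact: integrable_EFinD.
  by move=> w _; apply: expR_le_quadratic_cosh; rewrite // ltW.
have tK : t * (K + 1) <= - m.
  by rewrite -ler_pdivlMr// ge_min lexx orbT.
rewrite -subr_gt0 [ltRHS](_ : _ = t * (- m - t * K)); last by ring.
rewrite mulr_gt0// subr_gt0; apply: lt_le_trans tK.
by rewrite ltr_pM2l// ltrDl.
Qed.

End two_sided.

Section one_sided.
Variables (Y : T -> R) (q eps : R).
Hypotheses (q0 : 0 < q) (mY : measurable_fun setT Y) (eps0 : 0 < eps).
Hypothesis intY : forall t, - q <= t ->
  P.-integrable setT (EFin \o (fun w => expR (t * Y w))).
Hypothesis Yeps : P [set w | eps < Y w] != 0%E.

Let intY0 t : 0 <= t -> P.-integrable setT (EFin \o (fun w => expR (t * Y w))).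
Proof. by move=> t0; apply: intY; rewrite (le_trans _ t0)// oppr_le0 ltW. Qed.

Let intq : P.-integrable setT (EFin \o (fun w => expR (q * Y w))).
Proof. exact/intY0/ltW. Qed.
Let intNq : P.-integrable setT (EFin \o (fun w => expR (- q * Y w))).
Proof. exact: intY. Qed.
Let intY1 : P.-integrable setT (EFin \o Y).
Proof. exact: integrable_two_sided intq intNq. Qed.

Let mYeps : measurable [set w | eps < Y w].
Proof.
exact: measurable_lt.
Qed.

Let neq_subset (A : set T) : measurable A -> [set w | eps < Y w] `<=` A -> P A != 0%E.
Proof.
move=> mA YA; apply: contra Yeps => /eqP PA0; rewrite eq_le measure_ge0 andbT -PA0.
by apply: le_measure; rewrite ?inE.
Qed.

(** Integrating 1 + s Y <= e^(s Y) gives the weak inequality. It is strict because the two sides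
    differ on the event Y > eps, of positive probability. *)
Lemma mean_lt0_of_exp_moment1 (s : R) : 0 < s ->
  \int[P]_w expR (s * Y w) = 1 -> \int[P]_w Y w < 0.
Proof.
move=> s0 psi1.
have int1 := integrable_EFinD (integrable_probability_cst 1) (integrable_EFinZl s intY1).
have mf : measurable_fun setT (fun w => 1 + s * Y w).
  by apply: measurable_funD => //; exact: measurable_funM.
suff : 1 + s * \int[P]_w Y w < 1 by rewrite gtrDl pmulr_rlt0.
rewrite -[ltRHS]psi1.
have <- : \int[P]_w (1 + s * Y w) = 1 + s * \int[P]_w Y w.
  rewrite RintegralD//; last exact: integrable_EFinZl.
    by rewrite Rintegral_probability_cst RintegralZl.
  exact: integrable_probability_cst.
apply: lt_Rintegral => //; first exact/intY0/ltW.
  by move=> w; exact: expR_ge1Dx.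
apply: neq_subset; first by apply: measurable_lt => //; exact: measurable_expRM.
move=> w /= Yw; apply: expR_gt1Dx; rewrite mulf_neq0 ?gt_eqF//.
exact: lt_trans Yw.
Qed.

(** The chord over [0, s] has the value 1 at both ends after integration; strictness again comes
    from the event Y > eps. *)
Lemma exp_moment_interpolation (p s : R) : 0 < p < s ->
  \int[P]_w expR (s * Y w) = 1 -> \int[P]_w expR (p * Y w) < 1.
Proof.
move=> ps psi1; have /andP[p0 ps'] := ps.
have ints : P.-integrable setT (EFin \o (fun w => expR (s * Y w))).
  by apply: intY0; rewrite ltW// (lt_trans p0).
have int1 : P.-integrable setT (EFin \o (fun w => expR (s * Y w) + -1)).
  exact: integrable_EFinD ints (integrable_probability_cst (-1)).
have int2 := integrable_EFinD (integrable_probability_cst 1) (integrable_EFinZl (p / s) int1).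
have E : \int[P]_w (1 + p / s * (expR (s * Y w) + -1)) = 1.
  rewrite RintegralD//; [|exact: integrable_probability_cst|exact: integrable_EFinZl].
  rewrite Rintegral_probability_cst RintegralZl// RintegralD//; last exact: integrable_probability_cst.
  by rewrite psi1 Rintegral_probability_cst subrr mulr0 addr0.
rewrite -[ltRHS]E.
apply: lt_Rintegral => //; first exact/intY0/ltW.
  by move=> w; exact: expR_interpolation_le.
apply: neq_subset.
  apply: measurable_lt; first exact: measurable_expRM.
  by apply/measurable_EFinP; exact: measurable_int int2.
move=> w /= Yw; apply: expR_interpolation => //.
by rewrite gt_eqF//; exact: lt_trans Yw.
Qed.

Lemma exp_moment_gt1 (p : R) : 0 < p -> 0 < \int[P]_w Y w ->
  1 < \int[P]_w expR (p * Y w).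
Proof.
move=> p0 m0.
have intp : P.-integrable setT (EFin \o (fun w => expR (p * Y w))) by exact/intY0/ltW.
have int1 := integrable_EFinD (integrable_probability_cst 1) (integrable_EFinZl p intY1).
apply: (@lt_le_trans _ _ (\int[P]_w (1 + p * Y w))); last first.
  by apply: le_Rintegral => // w _; exact: expR_ge1Dx.
rewrite RintegralD//; [|exact: integrable_probability_cst|exact: integrable_EFinZl].
by rewrite Rintegral_probability_cst RintegralZl// ltrDl mulr_gt0.
Qed.

Lemma neg_exp_moment_lt1 : 0 < \int[P]_w Y w ->
  exists2 t, 0 < t <= q & \int[P]_w expR (- t * Y w) < 1.
Proof.
move=> m0.
have [||||t tq ht] := @exp_moment_lt1 (fun w => - Y w) q q0.
- exact: measurableT_comp.
- by under eq_fun do rewrite mulrN -mulNr.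
- by under eq_fun do rewrite mulrNN.
- have -> : \int[P]_w (- Y w) = - \int[P]_w Y w.
    rewrite -[RHS]mulN1r -RintegralZl//.
    by apply: eq_Rintegral => w _; rewrite mulN1r.
  by rewrite oppr_lt0.
- exists t; first exact: tq.
  apply: le_lt_trans ht; rewrite le_eqVlt; apply/orP; left; apply/eqP.
  by apply: eq_Rintegral => w _; rewrite mulrN mulNr.
Qed.

(** Dominated convergence for u in ]0, t + 1[: e^(u Y) is at most e^((t + 1) Y) where Y >= 0 and at
    most 1 elsewhere. *)
Lemma continuous_exp_moment (t : R) : 0 < t ->
  {for t, continuous (fun u : R => \int[P]_w expR (u * Y w))}.
Proof.
move=> t0.
apply: (@continuity_under_integral R _ T P (fun t w => expR (t * Y w)) setT measurableT
  0 (t + 1) _ _ (fun w => 1 + expR ((t + 1) * Y w))).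
- by move=> x /= /[!in_itv]/= /andP[x0 _]; exact/intY0/ltW.
- apply: aeW => w _ x _.
  apply: continuous_comp; last exact: continuous_expR.
  by apply: (@continuousM R R^o) => //; exact: cst_continuous.
- by apply: integrable_EFinD; [exact: integrable_probability_cst|apply: intY0; rewrite ltW// ltr_wpDr].
- move=> x /= /[!in_itv]/= /andP[x0 xt]; apply: aeW => w _.
  rewrite ger0_norm ?expR_ge0//.
  have p := expR_gt0 ((t + 1) * Y w).
  have [Y0|Y0] := lerP 0 (Y w).
    apply: (@le_trans _ _ (expR ((t + 1) * Y w))); last by rewrite lerDr.
    by rewrite ler_expR ler_wpM2r// ltW.
  apply: (@le_trans _ _ 1); last by rewrite lerDl ltW.
  by rewrite -expR0 ler_expR; nra.
- by apply/mem_set; rewrite /= in_itv/= t0 ltrDl ltr01.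
Qed.

Lemma exp_moment_eq1 : \int[P]_w Y w < 0 ->
  exists2 s, 0 < s & \int[P]_w expR (s * Y w) = 1.
Proof.
move=> m0.
have [t1 /andP[t10 t1q] ht1] := exp_moment_lt1 q0 mY intq intNq m0.
pose b := fine (P [set w | eps < Y w]).
have Pfin : P [set w | eps < Y w] \is a fin_num by exact: fin_num_measure.
have b0 : 0 < b.
  by rewrite fine_gt0// lt_def Yeps measure_ge0/= ltey_eq Pfin.
(* On the event Y > eps one has e^(t Y) >= t eps, so psi t >= t eps b, which reaches 1 at the
   inverse of eps b. The maximum with t1 orders the endpoints for the intermediate value theorem. *)
pose t2 := Num.max t1 (eps * b)^-1.
have t20 : 0 < t2 by rewrite lt_max t10.
have int2 : P.-integrable setT (EFin \o (fun w => expR (t2 * Y w))) by exact/intY0/ltW.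
have ht2 : 1 <= \int[P]_w expR (t2 * Y w).
  apply: (@le_trans _ _ (t2 * eps * b)).
    rewrite -mulrA -ler_pdivrMr ?mulr_gt0// div1r.
    by rewrite le_max lexx orbT.
  have intI : P.-integrable setT (EFin \o (\1_[set w | eps < Y w] : T -> R)).
    apply: (@dominated_integrable _ (fun=> 1)); [exact: measurable_indic| |exact: integrable_probability_cst].
    by move=> w; rewrite indicE; case: (_ \in _); rewrite ?normr1 ?normr0.
  have <- : \int[P]_w (t2 * eps * \1_[set w | eps < Y w] w) = t2 * eps * b.
    by rewrite RintegralZl// /Rintegral integral_indic// setIT.
  apply: le_Rintegral => //; first exact: integrable_EFinZl.
  move=> w _; rewrite indicE; case: (boolP (_ \in _)) => [|_]; last by rewrite mulr0 expR_ge0.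
  rewrite inE/= => Yw; rewrite mulr1.
  have := expR_ge1Dx (t2 * Y w) => h.
  have : t2 * eps <= t2 * Y w by rewrite ler_pM2l// ltW.
  by lra.
have t12 : t1 <= t2 by rewrite le_max lexx.
have [||s] := @IVT R (fun t => \int[P]_w expR (t * Y w)) t1 t2 1 t12.
- apply: continuous_in_subspaceT => t; rewrite inE/= in_itv/= => /andP[t1t _].
  by apply: continuous_exp_moment; exact: lt_le_trans t1t.
- by rewrite ge_min le_max (ltW ht1) ht2 orbT.
rewrite in_itv/= => /andP[t1s _] hs; exists s => //.
exact: lt_le_trans t1s.
Qed.

End one_sided.

End exp_moments.

(** * Moments of the gain of a layer *)

Section normal_estimates.
Context {R : realType}.
Local Notation mu := (@lebesgue_measure R).

Lemma normal_prob_set1 (m s x : R) : normal_prob m s [set x] = 0%E.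
Proof. exact: integral_set1. Qed.

(** The interval has length 1 and |x| <= |c| + 1 on it, so the density is at least its value at |c|
    + 1. *)
Lemma normal_prob_itv_gt0 (c : R) : (0 < normal_prob 0 1 `[c, (c + 1)%R])%E.
Proof.
pose b := normal_peak 1 * expR (- (`|c| + 1) ^+ 2 / (1 ^+ 2 *+ 2)) : R.
have b0 : 0 < b by rewrite mulr_gt0 ?expR_gt0// normal_peak_gt0// oner_neq0.
apply: (@lt_le_trans _ _ b%:E); first by rewrite lte_fin.
have -> : b%:E = (\int[mu]_(x in `[c, (c + 1)%R]) b%:E)%E.
  rewrite integral_cst//= lebesgue_measure_itv/= lte_fin ltrDl ltr01.
  by rewrite -EFinB addrAC subrr add0r mule1.
apply: ge0_le_integral => //=.
- by move=> x _; rewrite lee_fin ltW.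
- by apply/measurable_funTS/measurable_EFinP; exact: measurable_normal_pdf.
- move=> x; rewrite in_itv/= => /andP[cx xc]; rewrite lee_fin.
  rewrite normal_pdfE ?oner_neq0// /b ler_wpM2l ?normal_peak_ge0//.
  rewrite /normal_fun ler_expR subr0 !mulNr lerN2 ler_wpM2r//.
  rewrite -[x ^+ 2]real_normK ?num_real// ler_sqr ?nnegrE//.
  have -> : x = c + (x - c) by ring.
  rewrite (le_trans (ler_normD _ _))// lerD2l ger0_norm; lra.
Qed.

Lemma normal_prob_itv_le (r : R) : 0 <= r ->
  (normal_prob 0 1 `[(- r)%R, r] <= (normal_peak 1 * (r *+ 2))%:E)%E.
Proof.
move=> r0; apply: (@le_trans _ _ (\int[mu]_(x in `[(- r)%R, r]) (normal_peak 1)%:E)%E).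
  apply: ge0_le_integral => //=.
  - by move=> x _; rewrite lee_fin normal_pdf_ge0.
  - by apply/measurable_funTS/measurable_EFinP; exact: measurable_normal_pdf.
  - by move=> x _; rewrite lee_fin normal_pdf_ub// oner_neq0.
rewrite integral_cst//= lebesgue_measure_itv/= lte_fin.
case: ifPn => _; last by rewrite mule0 lee_fin mulr_ge0 ?normal_peak_ge0// mulrn_wge0.
by rewrite -EFinB -EFinM opprK -mulr2n.
Qed.

(** The factor e^(x^2 / 4) turns the standard density into a multiple of the density of variance
    2. *)
Lemma integral_normal_exp_sqr :
  (\int[normal_prob 0 1]_x (expR (x ^+ 2 / 4))%:E < +oo :> \bar R)%E.
Proof.
have mf : measurable_fun setT (fun x : R => (expR (x ^+ 2 / 4))%:E).
  apply/measurable_EFinP; apply: measurableT_comp => //.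
  by apply: measurable_funM => //; exact: measurable_funX.
rewrite (@ge0_integral_normal_prob R 0 1 _ mf); last by move=> x; rewrite lee_fin expR_ge0.
pose c : R := normal_peak 1 / normal_peak (Num.sqrt 2).
have s20 : Num.sqrt 2 != 0 :> R by rewrite gt_eqF// sqrtr_gt0.
have E x : ((expR (x ^+ 2 / 4))%:E * (normal_pdf 0 1 x)%:E =
            c%:E * (normal_pdf 0 (Num.sqrt 2) x)%:E :> \bar R)%E.
  rewrite -!EFinM; congr (_%:E).
  rewrite !normal_pdfE ?oner_neq0// /c [RHS]mulrA divfK ?gt_eqF ?normal_peak_gt0//.
  rewrite mulrCA; congr (_ * _); rewrite /normal_fun -expRD; congr expR.
  by rewrite sqr_sqrtr// subr0; field.
under eq_integral do rewrite E.
rewrite ge0_integralZl//.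
- by rewrite integral_normal_pdf mule1 ltry.
- by apply/measurable_EFinP; exact: measurable_normal_pdf.
- by move=> x _; rewrite lee_fin normal_pdf_ge0.
- by rewrite lee_fin divr_ge0// normal_peak_ge0.
Qed.

End normal_estimates.

(** * Negative moments from small-ball estimates *)

Section small_ball.
Context {R : realType} {dT : measure_display} {T : measurableType dT}.
Variable P : probability T R.

(** This is the freezing lemma with an empty past. *)
Lemma integral_iid_gaussian {I : eqType} (X : I -> T -> R) (s : R) i (f : R -> \bar R) :
  iid_gaussian P X s -> measurable_fun setT f -> (forall x, 0 <= f x)%E ->
  (\int[P]_w f (X i w) = \int[normal_prob 0 s]_x f x)%E.
Proof.
move=> [mX lawX indX] mf f0.
have i0 : i \notin (pred0 : pred I) by [].
have mF : measurable_fun setT (fun z : past X pred0 * R => f z.2).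
  exact: (measurableT_comp mf measurable_snd).
rewrite (@integral_past _ _ _ _ X mX P indX pred0 i (normal_prob 0 s) (fun z => f z.2)
  i0 (lawX i) mF (fun=> f0 _)).
by rewrite -[RHS](integral_probability_cst P).
Qed.

(** For u > 0 the left-hand side is u^(-1/2). If 4^-(n+1) < u <= 4^-n, it is at most 2^(n+1), which
    is the n-th term of the series; powers of 4 keep the square roots simple. *)
Lemma expR_half_ln_le_dyadic (u : R) : 0 <= u ->
  ((expR (- 2^-1 * ln u))%:E <=
   1 + \sum_(0 <= n <oo) ((2 : R) ^+ n.+1 * \1_[set x | x <= 4^-1 ^+ n] u)%:E)%E.
Proof.
have S0 v : (0 <= \sum_(0 <= n <oo) ((2 : R) ^+ n.+1 * \1_[set x | x <= 4^-1 ^+ n] v)%:E)%E.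
  by apply: nneseries_ge0 => n _ _; rewrite lee_fin mulr_ge0// exprn_ge0.
rewrite le_eqVlt => /predU1P[<-|u0].
  (* At u = 0 the convention [ln 0 = 0] makes the left-hand side 1, not infinity. *)
  by rewrite ln0// mulr0 expR0 leeDl.
have [u1|u1] := leP 1 u.
  apply: (@le_trans _ _ 1%E); last by rewrite leeDl.
  rewrite lee_fin -expR0 ler_expR mulNr oppr_le0 mulr_ge0// ln_ge0//.
have ex : exists n, 4^-1 ^+ n.+1 < u.
  have z1 : `|4^-1| < 1 :> R by rewrite ger0_norm; lra.
  have /cvgrPdist_lt/(_ _ u0)[N _ /(_ N.+1 (leqnSn _))] := cvg_expr z1.
  by rewrite /= sub0r normrN ger0_norm ?exprn_ge0//; exists N.
pose n := ex_minn ex.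
have [nlt nmin] : 4^-1 ^+ n.+1 < u /\ u <= 4^-1 ^+ n.
  rewrite /n; case: ex_minnP => -[|m] hm hmin; split => //.
    by rewrite expr0 ltW.
  by rewrite leNgt; apply/negP => /hmin; rewrite ltnn.
apply: (@le_trans _ _ (2 ^+ n.+1)%:E).
  rewrite lee_fin -[leRHS]lnK ?posrE ?exprn_gt0// ler_expR.
  rewrite lnXn// mulNr lerNl.
  have := ltW nlt; rewrite -ler_ln ?posrE ?exprn_gt0 ?invr_gt0// lnXn ?invr_gt0//.
  rewrite lnV ?posrE// (_ : 4 = 2 ^+ 2) ?lnXn//; last by ring.
  rewrite mulNrn -mulrnA mulnC mulrnA; set z := _ *+ n.+1 => h.
  by move: h; rewrite mulr2n; lra.
apply: (@le_trans _ _ (0 + (2 ^+ n.+1 * \1_[set x | x <= 4^-1 ^+ n] u)%:E)%E).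
  by rewrite add0e indicE mem_set// mulr1.
apply: leeD; first by rewrite lee_fin.
apply: le_trans (nneseries_lim_ge n.+1 _); last first.
  by move=> k _ _; rewrite lee_fin mulr_ge0// exprn_ge0.
rewrite big_nat_recr//= leeDr//; apply: sume_ge0 => k _.
by rewrite lee_fin mulr_ge0// exprn_ge0.
Qed.

(** Integrating the dyadic bound termwise gives 2^(n+1) P(U <= 4^-n) <= 2 C 2^-n, a convergent
    geometric series. *)
Lemma integrable_expR_half_ln (U : T -> R) (C : R) :
  measurable_fun setT U -> (forall w, 0 <= U w) ->
  (forall r, 0 <= r -> (P [set w | (U w <= r)%R] <= (C * r)%:E)%E) ->
  P.-integrable setT (EFin \o (fun w => expR (- 2^-1 * ln (U w)))).
Proof.
move=> mU U0 PU.
have mI n : measurable [set x : R | x <= 4^-1 ^+ n].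
  by rewrite (_ : [set _ | _] = `]-oo, (4^-1 ^+ n)]%classic)//; apply/seteqP; split => x /=;
     rewrite in_itv.
have mf : measurable_fun setT (fun w => expR (- 2^-1 * ln (U w))).
  apply: measurableT_comp => //; apply: measurable_funM => //.
  exact: measurableT_comp.
pose F n w : \bar R := (2 ^+ n.+1 * \1_[set x | x <= 4^-1 ^+ n] (U w))%:E.
have mF n : measurable_fun setT (F n).
  apply/measurable_EFinP; apply: measurable_funM => //.
  by apply: measurableT_comp mU; exact: measurable_indic.
have F0 n w : (0 <= F n w)%E by rewrite lee_fin mulr_ge0// exprn_ge0.
have mS : measurable_fun setT (fun w => \sum_(0 <= n <oo) F n w)%E.
  exact: ge0_emeasurable_sum.
apply/integrableP; split; first exact/measurable_EFinP.
under eq_integral do rewrite /= ger0_norm ?expR_ge0//.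
apply: (@le_lt_trans _ _ (\int[P]_w (1 + \sum_(0 <= n <oo) F n w))%E).
  apply: ge0_le_integral => //.
  - exact/measurable_EFinP.
  - exact: emeasurable_funD.
  - by move=> w _; exact: expR_half_ln_le_dyadic.
rewrite ge0_integralD//; last by move=> w _; exact: nneseries_ge0.
rewrite integral_probability_cst integral_nneseries//.
rewrite lte_add_pinfty ?ltry//.
apply: (@le_lt_trans _ _ (\sum_(0 <= n <oo) ((2 * C) * 2^-1 ^+ n)%:E)%E); last first.
  by apply: nneseries_geometric_lty; rewrite ger0_norm; lra.
apply: lee_nneseries => n *; first exact: integral_ge0.
rewrite /F; under eq_integral do rewrite EFinM.
rewrite ge0_integralZl//; last first.
  by apply/measurable_EFinP; apply: measurableT_comp mU; exact: measurable_indic.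
rewrite -[X in (_ * X)%E]/(\int[P]_w (\1_(U @^-1` [set x | x <= 4^-1 ^+ n]) w)%:E)%E.
rewrite integral_indic//; last by rewrite -[X in measurable X]setTI; exact: mU.
rewrite setIT; apply: (@le_trans _ _ ((2 ^+ n.+1)%:E * (C * 4^-1 ^+ n)%:E)%E).
  by apply: lee_wpmul2l; [rewrite lee_fin exprn_ge0|apply: PU; rewrite exprn_ge0].
rewrite -EFinM lee_fin le_eqVlt; apply/orP; left; apply/eqP.
rewrite exprS (_ : 4^-1 = 2^-1 * 2^-1 :> R); last by field.
have e : 2 ^+ n * 2^-1 ^+ n = 1 :> R by rewrite -exprMn divff// expr1n.
rewrite exprMn (_ : _ * _ = (2 ^+ n * 2^-1 ^+ n) * (2 * C * 2^-1 ^+ n)); last by ring.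
by rewrite e mul1r.
Qed.

End small_ball.

(** * Tails and moments of V *)

Section activation.
Context {R : realType} {dT : measure_display} {T : measurableType dT}.
Variables (P : probability T R) (d : nat) (a : R) (Zs : 'I_d -> T -> R).
Hypothesis iidZ : iid_gaussian P Zs 1.

Let V (w : T) : R := enorm (prelu_vec a (\col_i Zs i w)).

Let mZ : forall i, measurable_fun setT (Zs i). Proof. by have [] := iidZ. Qed.
Let mV : measurable_fun setT V. Proof. exact: measurable_enorm_prelu. Qed.
Let V0 w : 0 <= V w. Proof. exact: sqrtr_ge0. Qed.
Let VE w : V w ^+ 2 = \sum_i prelu a (Zs i w) ^+ 2.
Proof.
rewrite /V enorm_prelu_sqr sqr_sqrtr; last by apply: sumr_ge0 => i _; exact: sqr_ge0.
by apply: eq_bigr => i _; rewrite mxE.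
Qed.

Lemma normr_prelu_le_enorm w i : `|prelu a (Zs i w)| <= V w.
Proof.
rewrite -[leRHS]ger0_norm// -ler_sqr ?nnegrE// !real_normK ?num_real// VE.
by rewrite (bigD1 i)//= lerDl sumr_ge0// => j _; exact: sqr_ge0.
Qed.

(** ReLU kills every vector whose coordinates are all nonpositive. By independence the probability
    of this orthant is a product of positive factors. *)
Lemma enorm_prelu_eq0_gt0 : a = 0 -> (0 < P [set w | V w = 0%R])%E.
Proof.
move=> a0.
have [_ lawZ indZ] := iidZ.
have mI : measurable (`]-oo, 0%R]%classic : set R) by [].
apply: (@lt_le_trans _ _ (P (\big[setI/setT]_(i <- index_enum 'I_d) (Zs i @^-1` `]-oo, 0%R]%classic)))).
  rewrite (indZ _ (fun=> `]-oo, 0%R]%classic))// ?index_enum_uniq//.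
  apply: (@big_ind _ (fun x => 0 < x)%E) => //; first exact: mule_gt0.
  move=> i _; rewrite lawZ//; apply: lt_le_trans (normal_prob_itv_gt0 (-1)) _.
  apply: le_measure; rewrite ?inE//.
  by move=> x /=; rewrite !in_itv/= addNr => /andP[].
apply: le_measure; rewrite ?inE//.
- apply: big_ind => //; first exact: measurableI.
  by move=> i _; rewrite -[X in measurable X]setTI; exact: mZ.
- by have := @mV measurableT [set 0] (measurable_set1 _); rewrite setTI.
move=> w; rewrite -bigcap_seq => h /=.
apply/eqP; rewrite -sqrf_eq0 VE; apply/eqP; apply: big1 => i _.
have := h i; rewrite /= mem_index_enum in_itv/= => /(_ isT) Zi.
by rewrite /prelu ltNge Zi/= a0 mul0r expr0n.
Qed.

Hypotheses (d0 : (0 < d)%N) (a01 : 0 < a <= 1).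

Let i0 : 'I_d := Ordinal d0.

Lemma normr_le_prelu z : a * `|z| <= `|prelu a z|.
Proof.
have /andP[a0 a1] := a01.
by rewrite /prelu; case: ifPn => _; rewrite ?normrM ?(gtr0_norm a0)// ler_piMl.
Qed.

Lemma prelu_sqr_le z : prelu a z ^+ 2 <= z ^+ 2.
Proof.
have /andP[a0 a1] := a01.
rewrite /prelu; case: ifPn => _ //.
by rewrite exprMn ler_piMl ?sqr_ge0// expr_le1// ltW.
Qed.

(** One coordinate suffices: V <= r confines it to [- r / a, r / a], and the Gaussian density is
    bounded. *)
Lemma enorm_prelu_small r : 0 <= r ->
  (P [set w | (V w <= r)%R] <= (normal_peak 1 * 2 / a * r)%:E)%E.
Proof.
have /andP[a0 a1] := a01.
move=> r0; have [_ lawZ _] := iidZ.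
have ra0 : 0 <= r / a by rewrite divr_ge0// ltW.
apply: (@le_trans _ _ (P (Zs i0 @^-1` `[(- (r / a))%R, r / a]%classic))).
  apply: le_measure; rewrite ?inE//.
  - have := @mV measurableT `]-oo, r]%classic (measurable_itv _); rewrite setTI.
    by congr (measurable _); apply/seteqP; split => w /=; rewrite in_itv.
  - by rewrite -[X in measurable X]setTI; exact: mZ.
  move=> w /= Vr; rewrite in_itv/= -ler_norml ler_pdivlMr// mulrC.
  by rewrite (le_trans (normr_le_prelu _))// (le_trans (normr_prelu_le_enorm _ _)).
rewrite lawZ//; apply: le_trans (normal_prob_itv_le ra0) _.
by rewrite lee_fin le_eqVlt; apply/orP; left; apply/eqP; rewrite -mulr_natr; ring.
Qed.

Lemma enorm_prelu_gt0 : {ae P, forall w, 0 < V w}.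
Proof.
have [_ lawZ _] := iidZ.
exists (Zs i0 @^-1` [set 0]); split.
- by rewrite -[X in measurable X]setTI; exact: mZ.
- by rewrite lawZ//; exact: normal_prob_set1.
- move=> w /= /negP; rewrite -leNgt => Vw.
  have /andP[a0 a1] := a01.
  have := le_trans (normr_le_prelu (Zs i0 w)) (le_trans (normr_prelu_le_enorm w i0) Vw).
  by rewrite pmulr_rle0// normr_le0 => /eqP.
Qed.

(** By pigeonhole some coordinate satisfies Z_i^2 >= V^2 / d. Bounding by a sum over coordinates
    reduces integrability to one Gaussian variable, with no product over coordinates to
    integrate. *)
Lemma expR_enorm_sqr_le w :
  expR (V w ^+ 2 / (4 * d%:R)) <= \sum_i expR (Zs i w ^+ 2 / 4).
Proof.
have d0R : 0 < d%:R :> R by rewrite ltr0n.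
have [i Vi] : exists i, V w ^+ 2 <= d%:R * Zs i w ^+ 2.
  apply: contrapT => /forallNP h.
  have : V w ^+ 2 < V w ^+ 2; last by rewrite ltxx.
  rewrite {1}VE; apply: (@lt_le_trans _ _ (\sum_(i < d) V w ^+ 2 / d%:R)).
    apply: ltr_sum; first by apply/hasP; exists i0; rewrite ?mem_index_enum.
    move=> i _; apply: le_lt_trans (prelu_sqr_le _) _.
    by rewrite ltr_pdivlMr// mulrC ltNge; apply/negP; exact: h.
  by rewrite sumr_const card_ord -[leLHS]mulr_natr divfK ?gt_eqF.
rewrite (bigD1 i)//=; apply: (@le_trans _ _ (expR (Zs i w ^+ 2 / 4))); last first.
  by rewrite lerDl sumr_ge0// => j _; exact: expR_ge0.
rewrite ler_expR invfM mulrA mulrAC ler_pM2r ?invr_gt0//.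
by rewrite ler_pdivrMr// mulrC.
Qed.

Lemma integrable_expR_enorm_sqr :
  P.-integrable setT (EFin \o (fun w => expR (V w ^+ 2 / (4 * d%:R)))).
Proof.
have mexp : measurable_fun setT (fun x : R => expR (x ^+ 2 / 4)).
  apply: measurableT_comp => //.
  by apply: measurable_funM => //; exact: measurable_funX.
apply: (@dominated_integrable _ _ _ _ _ (fun w => \sum_i expR (Zs i w ^+ 2 / 4))).
- apply: measurableT_comp => //; apply: measurable_funM => //.
  exact: measurable_funX.
- by move=> w; rewrite ger0_norm ?expR_ge0//; exact: expR_enorm_sqr_le.
- rewrite (_ : _ \o _ = fun w => \sum_i (expR (Zs i w ^+ 2 / 4))%:E)%E; last first.
    by apply/funext => w /=; rewrite sumEFin.
  apply: integrable_sum => // i _; apply/integrableP; split.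
    by apply/measurable_EFinP; exact: (measurableT_comp mexp).
  under eq_integral do rewrite /= ger0_norm ?expR_ge0//.
  rewrite (@integral_iid_gaussian _ _ _ P _ Zs 1 i (fun x => (expR (x ^+ 2 / 4))%:E) iidZ).
  + exact: integral_normal_exp_sqr.
  + exact/measurable_EFinP.
  + by move=> x; rewrite lee_fin expR_ge0.
Qed.

(** For t >= 0 use ln V <= V and t V <= t^2 D + V^2 / D, with D = 4 d matching the integrable
    Gaussian exponential. For t < 0 the integrand is at most 1 where ln V >= 0, and below the case t
    = -1/2 elsewhere. *)
Lemma integrable_expR_ln_enorm (t : R) : - 2^-1 <= t ->
  P.-integrable setT (EFin \o (fun w => expR (t * ln (V w)))).
Proof.
have mL : measurable_fun setT (fun w => ln (V w)) by exact: measurableT_comp.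
move=> t2; have [t0|t0] := leP 0 t.
  pose D : R := 4 * d%:R.
  have D0 : 0 < D by rewrite mulr_gt0 ?ltr0n.
  apply: (@dominated_integrable _ _ _ _ _
    (fun w => expR (t ^+ 2 * D) * expR (V w ^+ 2 / D)) (measurable_expRM t mL)).
    move=> w; rewrite ger0_norm ?expR_ge0// -expRD ler_expR.
    have lnV : ln (V w) <= V w.
      have := V0 w; rewrite le_eqVlt => /predU1P[<-|/ln_sublinear/ltW//].
      by rewrite ln0.
    apply: (@le_trans _ _ (t * V w)); first exact: ler_wpM2l.
    have : 0 <= (t * D - V w) ^+ 2 / D by rewrite divr_ge0 ?sqr_ge0// ltW.
    have : 0 <= t * V w by rewrite mulr_ge0.
    have -> : (t * D - V w) ^+ 2 / D = t ^+ 2 * D + V w ^+ 2 / D - 2 * (t * V w).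
      by field; rewrite gt_eqF.
    by lra.
  exact: (integrable_EFinZl _ integrable_expR_enorm_sqr).
have int2 := integrable_expR_half_ln mV V0 enorm_prelu_small.
apply: (dominated_integrable (measurable_expRM t mL) _
  (integrable_EFinD (integrable_probability_cst P 1) int2)) => w.
rewrite ger0_norm ?expR_ge0//.
have p := expR_gt0 (- 2^-1 * ln (V w)).
have [L0|L0] := lerP 0 (ln (V w)).
  apply: (@le_trans _ _ 1); last by rewrite lerDl ltW.
  by rewrite -expR0 ler_expR; nra.
apply: (@le_trans _ _ (expR (- 2^-1 * ln (V w)))); last by rewrite lerDr.
by rewrite ler_expR; nra.
Qed.

Lemma ln_enorm_unbounded (M : R) : P [set w | M < ln (V w)] != 0%E.
Proof.
have [_ lawZ _] := iidZ.
(* If the first coordinate is at least c, it is positive and so unchanged by the activation; hence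
   ln V >= M + 1 > M. *)
pose c := expR (M + 1).
have c0 : 0 < c by exact: expR_gt0.
rewrite gt_eqF//.
apply: lt_le_trans (_ : P (Zs i0 @^-1` `[c, (c + 1)%R]%classic) <= _)%E.
  by rewrite lawZ//; exact: normal_prob_itv_gt0.
apply: le_measure; rewrite ?inE//.
- by rewrite -[X in measurable X]setTI; exact: mZ.
- have mL : measurable_fun setT (fun w => ln (V w)) by exact: measurableT_comp.
  exact: measurable_lt.
move=> w /=; rewrite in_itv/= => /andP[cZ _].
have Z0 : 0 < Zs i0 w by exact: lt_le_trans cZ.
have cV : c <= V w.
  apply: le_trans (normr_prelu_le_enorm w i0).
  by rewrite /prelu Z0 gtr0_norm.
apply: (@lt_le_trans _ _ (ln c)); first by rewrite expRK ltrDl.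
by rewrite ler_ln// posrE// (lt_le_trans c0).
Qed.

End activation.

(** * Limits of the layers *)

Section powR_limits.
Context {R : realType}.
Implicit Type u : R^nat.

Lemma cvg0_of_powR u (p : R) : 0 < p -> (forall k, 0 <= u k) ->
  u k `^ p @[k --> \oo] --> 0 -> u @ \oo --> 0.
Proof.
move=> p0 u0 /cvgrPdist_lt up; apply/cvgrPdist_lt => e e0.
have := up _ (powR_gt0 p e0); apply: filterS => k /=.
rewrite !sub0r !normrN ger0_norm ?powR_ge0// ger0_norm// => uk.
rewrite ltNge; apply/negP => eu; move: uk; rewrite ltNge => /negP; apply.
by rewrite ge0_ler_powR ?nnegrE// ltW.
Qed.

(** Positivity of u matters: a negative power of 0 is 0 here, so terms equal to 0 would look like
    terms near infinity. *)
Lemma cvgy_of_powRN u (p : R) : 0 < p -> (forall k, 0 < u k) ->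
  u k `^ (- p) @[k --> \oo] --> 0 -> u @ \oo --> +oo.
Proof.
move=> p0 u0 /cvgrPdist_lt up; apply/cvgryPgt => A.
pose B := Num.max A 1.
have B0 : 0 < B by rewrite lt_max ltr01 orbT.
have := up _ (powR_gt0 (- p) B0); apply: filterS => k /=.
rewrite sub0r normrN ger0_norm ?powR_ge0// !powRN ltf_pV2 ?posrE ?powR_gt0// => Bu.
apply: (@le_lt_trans _ _ B); first by rewrite le_max lexx.
rewrite ltNge; apply/negP => uB; move: Bu; rewrite ltNge => /negP; apply.
by rewrite ge0_ler_powR ?nnegrE// ltW.
Qed.

Lemma cvgy_geometric (c r : R) : 0 < c -> 1 < r ->
  c * r ^+ k @[k --> \oo] --> +oo.
Proof.
move=> c0 r1; have r0 : 0 < r by exact: lt_trans r1.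
have z1 : `|r^-1| < 1 by rewrite gtr0_norm ?invr_gt0// invf_lt1.
apply/cvgryPgt => A; have B0 : 0 < c / (`|A| + 1) by rewrite divr_gt0// ltr_wpDl.
have /cvgrPdist_lt/(_ _ B0) := cvg_expr z1; apply: filterS => k /=.
rewrite sub0r normrN ger0_norm ?exprn_ge0 ?invr_ge0 ?ltW//.
rewrite exprVn ltr_pdivlMr ?ltr_wpDl// mulrC ltr_pdivrMr ?exprn_gt0// => h.
by apply: lt_trans h; rewrite (le_lt_trans (ler_norm A))// ltrDl.
Qed.

End powR_limits.

Section nonzero_indicator.
Context {R : realType}.

Definition nonzero (u : R) : R := \1_(~` [set 0]) u.

Lemma nonzeroE u : nonzero u = (u != 0)%:R.
Proof.
rewrite /nonzero indicE; congr (_%:R); congr nat_of_bool.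
by apply/idP/idP => [/set_mem/eqP//|/eqP h]; exact/mem_set.
Qed.

Lemma measurable_nonzero : measurable_fun setT nonzero.
Proof. by apply: measurable_indic; exact: measurableC. Qed.

Lemma nonzeroM x y : nonzero (x * y) = nonzero x * nonzero y.
Proof. by rewrite !nonzeroE mulf_eq0 negb_or -natrM mulnb. Qed.

Lemma nonzero_ge0 x : 0 <= nonzero x.
Proof. by rewrite nonzeroE. Qed.

End nonzero_indicator.

Lemma enorm_gt0 {R : realType} (d : nat) (x : 'cV[R]_d) : x != 0 -> 0 < enorm x.
Proof.
move=> x0; rewrite sqrtr_gt0 lt_def sumr_ge0 ?andbT; last by move=> i _; exact: sqr_ge0.
apply: contra x0 => /eqP/psumr_eq0P x0; apply/eqP/matrixP => i j.
rewrite ord1 mxE; apply/eqP; rewrite -sqrf_eq0; apply/eqP; apply: x0 => // k _.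
exact: sqr_ge0.
Qed.

(** * The mean log gain and the critical scale *)

Section lyapunov.
Context {R : realType} {dT : measure_display} {T : measurableType dT}.
Variables (P : probability T R) (d : nat) (a sigma : R) (Zs : 'I_d -> T -> R).
Hypotheses (d0 : (0 < d)%N) (a01 : 0 < a <= 1) (sigma0 : 0 < sigma).
Hypothesis iidZ : iid_gaussian P Zs 1.

Let V (w : T) : R := enorm (prelu_vec a (\col_i Zs i w)).
Let Y (w : T) : R := ln sigma + ln (V w).

Let mV : measurable_fun setT V.
Proof. by apply: measurable_enorm_prelu; have [] := iidZ. Qed.

Lemma measurable_log_gain : measurable_fun setT Y.
Proof. by apply: measurable_funD => //; exact: measurableT_comp. Qed.

Let expRY t w : expR (t * Y w) = expR (t * ln sigma) * expR (t * ln (V w)).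
Proof. by rewrite -expRD mulrDr. Qed.

Lemma integrable_expR_log_gain t : - 2^-1 <= t ->
  P.-integrable setT (EFin \o (fun w => expR (t * Y w))).
Proof.
move=> t2; under eq_fun do rewrite expRY.
by apply: integrable_EFinZl; exact: integrable_expR_ln_enorm.
Qed.

Lemma log_gain_gt1 : P [set w | 1 < Y w] != 0%E.
Proof.
have := @ln_enorm_unbounded _ _ _ P d a Zs iidZ d0 (1 - ln sigma).
by under eq_set do rewrite ltrBlDl.
Qed.

(** The integrands differ only at V = 0, where the power is 0 but the exponential is not; that event
    is null. *)
Lemma integral_powR_ln (c t : R) : 0 < c -> t != 0 ->
  (\int[P]_w ((c * V w) `^ t)%:E = \int[P]_w (expR (t * (ln c + ln (V w))))%:E)%E.
Proof.
move=> c0 t0; apply: ae_eq_integral => //.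
- apply/measurable_EFinP; apply: (measurableT_comp (measurable_powR t)).
  exact: measurable_funM.
- apply/measurable_EFinP; apply: measurable_expRM; apply: measurable_funD => //.
  exact: measurableT_comp.
- have := @enorm_prelu_gt0 _ _ _ P d a Zs iidZ d0 a01; apply: filterS => w V0 _.
  by rewrite /powR mulf_eq0 (gt_eqF c0) (gt_eqF V0)/= lnM.
Qed.

Lemma integral_powR_gain t : - 2^-1 <= t -> t != 0 ->
  (\int[P]_w ((sigma * V w) `^ t)%:E = (\int[P]_w expR (t * Y w))%R%:E)%E.
Proof.
move=> t2 t0; rewrite integral_powR_ln// fineK//.
exact: (integrable_fin_num measurableT (integrable_expR_log_gain t2)).
Qed.

(** [ln V] is integrable because its exponential moments at 1/2 and -1/2 are finite, so [mu_a] is a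
    real number. The rule ln(V^2) = 2 ln V holds at V = 0 too, by convention. *)
Lemma mu_aE : mu_a P Zs a sigma = (\int[P]_w Y w)%:E.
Proof.
have int0 t : - 2^-1 <= t -> P.-integrable setT (EFin \o (fun w => expR (t * ln (V w)))).
  exact: integrable_expR_ln_enorm.
have mL : measurable_fun setT (fun w => ln (V w)) by exact: measurableT_comp.
have intL : P.-integrable setT (EFin \o (fun w => ln (V w))).
  by apply: (integrable_two_sided (q := 2^-1)) => //; apply: int0; rewrite // (@le_trans _ _ 0)// oppr_le0.
have -> : \int[P]_w Y w = ln sigma + \int[P]_w ln (V w).
  by rewrite RintegralD// ?Rintegral_probability_cst//; exact: integrable_probability_cst.
rewrite /mu_a EFinD; congr (_ + _)%E.
rewrite fineK; last exact: (integrable_fin_num measurableT intL).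
rewrite [in LHS](eq_integral (fun w => 2%:E * (ln (V w))%:E)%E); last first.
  move=> w _; suff E : ln (V w ^+ 2) = 2 * ln (V w).
    by rewrite -EFinM -E.
  have : 0 <= V w by exact: sqrtr_ge0.
  rewrite le_eqVlt => /predU1P[<-|V0]; first by rewrite expr0n/= ln0// mulr0.
  by rewrite lnXn// mulr_natl.
by rewrite integralZl// muleA -EFinM mulVf// mul1e.
Qed.

(** The exponential moment factors as sigma^s M with M = E V^s, and M > 0 allows solving sigma^s M =
    1 for sigma. *)
Lemma sigma_barP s : 0 < s ->
  sigma = sigma_bar P Zs a s <-> \int[P]_w expR (s * Y w) = 1.
Proof.
move=> s0; have s2 : - 2^-1 <= s by rewrite (@le_trans _ _ 0) ?oppr_le0// ltW.
have sn0 : s != 0 by rewrite gt_eqF.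
have intV := @integrable_expR_ln_enorm _ _ _ P d a Zs iidZ d0 a01 _ s2.
set M := \int[P]_w expR (s * ln (V w)).
have -> : sigma_bar P Zs a s = M `^ (- s^-1).
  congr (fine _ `^ _); transitivity (\int[P]_w ((1 * V w) `^ s)%:E)%E.
    by apply: eq_integral => w _; rewrite mul1r.
  by rewrite (integral_powR_ln ltr01 sn0); apply: eq_integral => w _; rewrite ln1 add0r.
have -> : \int[P]_w expR (s * Y w) = sigma `^ s * M.
  rewrite -RintegralZl//; apply: eq_Rintegral => w _.
  by rewrite expRY /powR gt_eqF.
have M0 : 0 < M.
  have -> : 0 = \int[P]_w (0 : R) by rewrite Rintegral_probability_cst.
  apply: lt_Rintegral => //; first exact: integrable_probability_cst.
  rewrite (_ : [set _ | _] = setT) ?probability_setT ?oner_neq0//.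
  by apply/seteqP; split => w //= _; exact: expR_gt0.
split => [->|h].
  by rewrite -powRrM mulNr mulVf// powR_inv1 ?(ltW M0)// mulVf// gt_eqF.
have -> : M = sigma `^ (- s).
  have ns : sigma `^ s != 0 by rewrite gt_eqF// powR_gt0.
  by apply: (mulfI ns); rewrite h powRN divff.
by rewrite -powRrM mulrNN divff// powRr1// ltW.
Qed.

End lyapunov.

Section layers_limits.
Context {R : realType} {dT : measure_display} {T : measurableType dT}.
Variables (P : probability T R) (d : nat) (a sigma : R) (x0 : 'cV[R]_d).
Variables (W : nat -> T -> 'M[R]_d) (Zs : 'I_d -> T -> R).
Hypotheses (d0 : (0 < d)%N) (sigma0 : 0 < sigma) (x00 : x0 != 0).
Hypothesis iidW :
  iid_gaussian P (fun t : nat * 'I_d * 'I_d => fun w => W t.1.1 w t.1.2 t.2) sigma.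
Hypothesis iidZ : iid_gaussian P Zs 1.

Let V (w : T) : R := enorm (prelu_vec a (\col_i Zs i w)).
Let Y (w : T) : R := ln sigma + ln (V w).
Let x k w := layers a x0 W k w.
Let nx0 k w : 0 <= enorm (x k w). Proof. exact: sqrtr_ge0. Qed.

Let mV : measurable_fun setT V.
Proof. by apply: measurable_enorm_prelu; have [] := iidZ. Qed.

Lemma ae_layers_cvg0_relu : a = 0 ->
  {ae P, forall w, enorm (x k w) @[k --> \oo] --> 0}.
Proof.
move=> a0; pose A := [set w | V w = 0].
have mA : measurable A by have := @mV measurableT [set 0] (measurable_set1 _); rewrite setTI.
have PA0 : (0 < P A)%E by exact: enorm_prelu_eq0_gt0.
have E : (\int[P]_v (nonzero (sigma * V v))%:E = (fine (P (~` A)))%:E)%E.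
  rewrite fineK ?fin_num_measure//; last exact: measurableC.
  rewrite -(setIT (~` A)) -integral_indic//; last exact: measurableC.
  apply: eq_integral => w _; congr (_%:E).
  rewrite nonzeroE mulf_eq0 (gt_eqF sigma0)/= indicE in_setC; congr (_%:R); congr nat_of_bool.
  by congr negb; apply/idP/idP => [/eqP ?|/set_mem/eqP//]; exact/mem_set.
have r1 : fine (P (~` A)) < 1.
  rewrite -lte_fin fineK ?fin_num_measure//; last exact: measurableC.
  by rewrite probability_setC// lteBlDr ?fin_num_measure// lteDl ?fin_num_measure.
have := ae_multiplicative_layers_cvg0 x0 sigma0 iidW iidZ measurable_nonzero
  (@nonzero_ge0 R) (fun u v _ _ => nonzeroM u v) E r1.
apply: filterS => w /cvgrPdist_lt h; apply/cvgrPdist_lt => e e0.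
(* An indicator below 1 is 0, so the layers are eventually exactly 0. *)
have := h _ ltr01; apply: filterS => k /=.
rewrite !sub0r !normrN nonzeroE; have [->|] := eqVneq (enorm _) 0; first by rewrite normr0.
by rewrite normr1 ltxx.
Qed.

Hypothesis a01 : 0 < a <= 1.

Let intY t : - 2^-1 <= t -> P.-integrable setT (EFin \o (fun w => expR (t * Y w))).
Proof. exact: integrable_expR_log_gain. Qed.

Let half0 : 0 < 2^-1 :> R. Proof. by rewrite invr_gt0. Qed.

Let ge_half t : 0 <= t -> - 2^-1 <= t :> R.
Proof. by apply: le_trans; rewrite oppr_le0. Qed.

Lemma integral_powR_layers (p : R) k : 0 < p ->
  (\int[P]_w (enorm (x k w) `^ p)%:E =
   (enorm x0 `^ p * (\int[P]_w expR (p * Y w)) ^+ k)%:E)%E.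
Proof.
move=> p0.
apply: (@integral_multiplicative_layers _ _ _ P d a sigma x0 W Zs sigma0 iidW iidZ (@powR R ^~ p)).
- exact: measurable_powR.
- by move=> u; exact: powR_ge0.
- by move=> u v; exact: powRM.
- by apply: integral_powR_gain => //; [exact/ge_half/ltW|rewrite gt_eqF].
Qed.

Lemma ae_powR_layers_cvg0 (t : R) : - 2^-1 <= t -> t != 0 ->
  \int[P]_w expR (t * Y w) < 1 ->
  {ae P, forall w, enorm (x k w) `^ t @[k --> \oo] --> 0}.
Proof.
move=> t2 t0.
apply: (@ae_multiplicative_layers_cvg0 _ _ _ P d a sigma x0 W Zs sigma0 iidW iidZ (@powR R ^~ t)).
- exact: measurable_powR.
- by move=> u; exact: powR_ge0.
- by move=> u v; exact: powRM.
- exact: integral_powR_gain.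
Qed.

Lemma ae_layers_cvg0 (p : R) : 0 < p -> \int[P]_w expR (p * Y w) < 1 ->
  {ae P, forall w, enorm (x k w) @[k --> \oo] --> 0}.
Proof.
move=> p0 h.
have := ae_powR_layers_cvg0 (ge_half (ltW p0)) (lt0r_neq0 p0) h.
by apply: filterS => w; exact: cvg0_of_powR.
Qed.

(** The functional used for ReLU now has ratio r = 1, since V > 0 almost surely; hence each P(x_k !=
    0) is 1. This supplies the positivity needed to read divergence off negative powers. *)
Lemma ae_layers_neq0 : {ae P, forall w, forall k, 0 < enorm (x k w)}.
Proof.
apply: ae_foralln => k.
have E : (\int[P]_v (nonzero (sigma * V v))%:E = 1%:E)%E.
  rewrite -[RHS](integral_probability_cst P); apply: ae_eq_integral => //.
    apply/measurable_EFinP; apply: (measurableT_comp measurable_nonzero).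
    exact: measurable_funM.
  have := @enorm_prelu_gt0 _ _ _ P d a Zs iidZ d0 a01; apply: filterS => w V0 _.
  by rewrite nonzeroE mulf_neq0 ?gt_eqF.
have := @integral_multiplicative_layers _ _ _ P d a sigma x0 W Zs sigma0 iidW iidZ
  _ _ measurable_nonzero (@nonzero_ge0 R) (fun u v _ _ => nonzeroM u v) E k.
rewrite expr1n mulr1 (nonzeroE (enorm x0)) (gt_eqF (enorm_gt0 x00)) => Ek.
have mx : measurable_fun setT (fun w => enorm (x k w)).
  exact: (measurable_enorm_layers a x0 iidW k).
pose B := [set w | enorm (x k w) = 0].
have mB : measurable B by have := @mx measurableT [set 0] (measurable_set1 _); rewrite setTI.
exists B; split => //.
- have PC : P (~` B) = 1%E.
    transitivity (\int[P]_w (\1_(~` B) w)%:E)%E.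
      by rewrite integral_indic ?setIT//; exact: measurableC.
    by rewrite -[RHS]Ek; apply: eq_integral.
  by have := probability_setC P (measurableC mB); rewrite setCK PC subee.
- move=> w /= /negP; rewrite -leNgt => xw.
  by apply/eqP; rewrite eq_le xw nx0.
Qed.

Lemma ae_layers_cvgy : 0 < \int[P]_w Y w ->
  {ae P, forall w, enorm (x k w) @[k --> \oo] --> +oo}.
Proof.
move=> m0; have mY : measurable_fun setT Y by exact: (@measurable_log_gain _ _ _ P d a sigma Zs iidZ).
have [t /andP[t0 t2] ht] := neg_exp_moment_lt1 half0 mY intY m0.
have tN : - 2^-1 <= - t by rewrite lerN2.
have tN0 : - t != 0 by rewrite oppr_eq0 gt_eqF.
have := ae_powR_layers_cvg0 tN tN0 ht.
have := ae_layers_neq0.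
apply: filterS2 => w x_gt0; exact: cvgy_of_powRN.
Qed.

End layers_limits.

Unset Implicit Arguments.
Set Strict Implicit.

Theorem mainTheorem9 (R : realType) (dT : measure_display)
  (T : measurableType dT) (P : probability T R) (d : nat)
  (a sigma : R) (x0 : 'cV[R]_d)
  (W : nat -> T -> 'M[R]_d) (Zs : 'I_d -> T -> R) :
  (0 < d)%N -> 0 <= a <= 1 -> 0 < sigma -> x0 != 0 ->
  iid_gaussian P (fun t : nat * 'I_d * 'I_d => fun w => W t.1.1 w t.1.2 t.2) sigma ->
  iid_gaussian P Zs 1 ->
  (* (a) *)
  (a = 0 ->
     {ae P, forall w, (fun k => enorm (layers a x0 W k w)) @ \oo --> 0}) /\
  (* (b) *)
  (0 < a ->
     ((mu_a P Zs a sigma < 0)%E <-> exists2 s : R, 0 < s & sigma = sigma_bar P Zs a s) /\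
     (forall s : R, 0 < s -> sigma = sigma_bar P Zs a s ->
        (1 <= s ->
           {ae P, forall w, (fun k => enorm (layers a x0 W k w)) @ \oo --> 0}) /\
        (s < 1 ->
           (forall p : R, 0 < p < s ->
              (fun k => (\int[P]_w ((enorm (layers a x0 W k w)) `^ p)%:E)%E)
                @ \oo --> 0%E) /\
           (exists nk : nat -> nat, (forall k, (nk k < nk k.+1)%N) /\
              {ae P, forall w,
                 (fun k => enorm (layers a x0 W (nk k) w)) @ \oo --> 0})))) /\
  (* (c) *)
  (0 < a -> (0 < mu_a P Zs a sigma)%E ->
     (forall p : R, 0 < p ->
        (fun k => (\int[P]_w ((enorm (layers a x0 W k w)) `^ p)%:E)%E)
          @ \oo --> +oo%E) /\
     (exists nk : nat -> nat, (forall k, (nk k < nk k.+1)%N) /\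
        {ae P, forall w,
           (fun k => enorm (layers a x0 W (nk k) w)) @ \oo --> +oo})).
Proof.
move=> d0 /andP[a0 a1] sigma0 x00 iidW iidZ.
split; first exact: (ae_layers_cvg0_relu _ sigma0 iidW iidZ).
pose Y w := ln sigma + ln (enorm (prelu_vec a (\col_i Zs i w))).
have half0 : 0 < 2^-1 :> R by rewrite invr_gt0.
have [a_gt0|] := ltP 0 a; last by move=> ?; split.
have a01 : 0 < a <= 1 by rewrite a_gt0.
have mY : measurable_fun setT Y by exact: (@measurable_log_gain _ _ _ P d a sigma Zs iidZ).
have intY t : - 2^-1 <= t -> P.-integrable setT (EFin \o (fun w => expR (t * Y w))).
  exact: integrable_expR_log_gain.
have Y1 : P [set w | 1 < Y w] != 0%E by exact: log_gain_gt1.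
have muE := mu_aE sigma d0 a01 iidZ.
have barP s := sigma_barP d0 a01 sigma0 iidZ (s := s).
split=> _.
- split.
    rewrite muE lte_fin; split=> [mu0|[s s0 /(barP _ s0)]].
      have [s s0 hs] := exp_moment_eq1 half0 mY ltr01 intY Y1 mu0.
      by exists s => //; apply/barP.
    exact: (mean_lt0_of_exp_moment1 half0 mY ltr01 intY Y1).
  move=> s s0 /(barP _ s0) hs.
  have psi p : 0 < p < s -> \int[P]_w expR (p * Y w) < 1.
    by move=> ps; exact: (exp_moment_interpolation half0 mY ltr01 intY Y1 ps).
  have cvg0 : {ae P, forall w, (fun k => enorm (layers a x0 W k w)) @ \oo --> 0}.
    (* Any exponent strictly between 0 and s would do. *)
    have s2 : 0 < s / 2 < s by rewrite divr_gt0//= ltr_pdivrMr// ltr_pMr// ltr1n.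
    have /andP[s20 _] := s2.
    exact: (ae_layers_cvg0 x0 d0 sigma0 iidW iidZ a01 s20 (psi _ s2)).
  (* Almost sure convergence was obtained for every s > 0, so it settles both s >= 1 and the
     subsequence claim for s < 1. *)
  split=> // _; split; last by exists id.
  move=> p ps; have /andP[p0 _] := ps.
  under eq_fun do rewrite (integral_powR_layers x0 d0 sigma0 iidW iidZ a01 _ p0).
  apply: cvg_EFin; first exact: nearW.
  apply: (@cvg_geometric R (enorm x0 `^ p)).
  rewrite ger0_norm; last by apply: Rintegral_ge0 => w _; exact: expR_ge0.
  exact: psi.
- rewrite muE lte_fin => m0; split; last first.
    by exists id; split => //; exact: (ae_layers_cvgy d0 sigma0 x00 iidW iidZ a01).
  move=> p p0.
  under eq_fun do rewrite (integral_powR_layers x0 d0 sigma0 iidW iidZ a01 _ p0).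
  apply/cvgeryP; apply: cvgy_geometric; first by rewrite powR_gt0// enorm_gt0.
  exact: (exp_moment_gt1 half0 mY intY p0 m0).
Qed.
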